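(* Let $0\le k<n$ and let $W\in\mathrm{Gr}_{k+1,n}^{>0}$. Let $\mathcal{S}:=\bigsqcup_{M\in\overline{\mathcal{M}_{n,k,1}}}S_M\subseteq \mathrm{Gr}_{k,n}^{\ge 0}$ and define $$\phi_W:\mathcal{S}\to\mathcal{B}_{n,k,1}(W),\qquad V\mapsto V^\perp\cap W.$$ Then $\phi_W$ is a homeomorphism, and it induces a poset isomorphism between the stratification of $\mathcal{S}$ (its cells $S_M$, $M\in\overline{\mathcal{M}_{n,k,1}}$, ordered by containment of closures) and the stratification of $\mathcal{B}_{n,k,1}(W)$ (its strata $\mathcal{B}_\sigma(W)$ ordered by containment of closures).
   Context: $\mathrm{Gr}_{k,n}$ is the real Grassmannian of $k$-dimensional subspaces of $\mathbb{R}^n$, with Plücker coordinates $\Delta_I$, $I\in\binom{[n]}{k}$. $\mathrm{Gr}_{k,n}^{\ge0}$ (resp. $\mathrm{Gr}_{k,n}^{>0}$) is the set of $V$ whose Plücker coordinates can be chosen all $\ge0$ (resp. all $>0$). For a set $M\subseteq\binom{[n]}{k}$, the positroid cell $S_M$ is the set of $V\in \mathrm{Gr}_{k,n}^{\ge0}$ with $\Delta_I(V)>0$ for $I\in M$ and $\Delta_I(V)=0$ for $I\notin M$. $V^\perp$ is the orthogonal complement in $\mathbb{R}^n$. Matroids: a matroid of rank $k$ on $[n]$ is identified with its set of bases. For matroids $M',M$ of the same rank on the same ground set, $M'\le M$ means every basis of $M'$ is a basis of $M$. Direct sum $M\oplus N$ of matroids on disjoint ground sets has bases $B\sqcup C$.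 $\mathcal{M}_{n,k,1}$ is the set of matroids on $[n]$ of the form $M_1\oplus\cdots\oplus M_{n-k}$, where $E_1\sqcup\cdots\sqcup E_{n-k}$ is a partition of $[n]$ into nonempty intervals of consecutive integers and $M_j$ is the uniform matroid of rank $|E_j|-1$ on $E_j$. $\overline{\mathcal{M}_{n,k,1}}$ is the set of rank-$k$ matroids $M'$ on $[n]$ with $M'\le M$ for some $M\in\mathcal{M}_{n,k,1}$ (these are all positroids, i.e. $S_{M'}\neq\emptyset$). Sign variation: for $v\in\mathbb{R}^n$, $\mathrm{var}(v)$ is the number of sign changes in the sequence $v_1,\dots,v_n$ ignoring zeros ($\mathrm{var}(0):=-1$); $\overline{\mathrm{var}}(v):=\max\{\mathrm{var}(w): w\in\mathbb{R}^n,\ w_i=v_i\text{ whenever }v_i\ne0\}$. These are defined likewise for sign vectors in $\{0,+,-\}^n$; $\mathrm{sign}(v)\in\{0,+,-\}^n$ is the componentwise sign. Amplituhedron ($m=1$): $\mathcal{B}_{n,k,1}(W):=\{V^\perp\cap W: V\in \mathrm{Gr}_{k,n}^{\ge0}\}$; each $V^\perp\cap W$ is a line, so $\mathcal{B}_{n,k,1}(W)\subseteq\mathbb{P}(W)$. Its strata: for a nonzero $\sigma\in\{0,+,-\}^n$ with $\overline{\mathrm{var}}(\sigma)=k$ (considered modulo multiplication by $\pm1$), $\mathcal{B}_\sigma(W):=\{\langle w\rangle: w\in W\setminus\{0\},\ \mathrm{sign}(w)=\pm\sigma\}$. *)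

(* Defs.v *)
From HB Require Import structures.
From mathcomp Require Import all_boot all_order all_algebra.
From mathcomp Require Import all_classical all_reals all_analysis.

Set Implicit Arguments.
Unset Strict Implicit.
Unset Printing Implicit Defensive.

Import Order.TTheory GRing.Theory Num.Theory.
Import numFieldNormedType.Exports.

Local Open Scope classical_set_scope.
Local Open Scope ring_scope.

(** * Grassmannians *)

Section Grassmannian.
Variables (R : realType) (n : nat).

Definition rowspan k (A : 'M[R]_(k, n)) : {vspace 'rV[R]_n} :=
  <<[seq row i A | i <- enum 'I_k]>>%VS.

Definition full_rank k : set 'M[R]_(k, n) := [set A | row_free A].

(* The topology on the set of all subspaces of R^n is that of the disjoint
   union over k of the Grassmannians Gr_{k,n}, each being the quotient of the
   space of full-rank k x n matrices by the map A |-> rowspan A.  [subspace D]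
   is the library's subspace topology; its points outside D are isolated, so
   they do not constrain openness. *)
Definition Gr_open : set_system {vspace 'rV[R]_n} :=
  [set U | forall k,
     open ((@rowspan k) @^-1` U : set (subspace (@full_rank k)))].

Lemma Gr_openT : Gr_open setT.
Proof. by move=> k; rewrite preimage_setT; exact: openT. Qed.

Lemma Gr_openI : setI_closed Gr_open.
Proof. by move=> U V oU oV k; rewrite preimage_setI; exact: openI. Qed.

Lemma Gr_open_bigU (I : Type) (f : I -> set {vspace 'rV[R]_n}) :
  (forall i, Gr_open (f i)) -> Gr_open (\bigcup_i f i).
Proof.
by move=> of_ k; rewrite preimage_bigcup; apply: bigcup_open => i _; exact: of_.
Qed.

HB.instance Definition _ :=
  isOpenTopological.Build {vspace 'rV[R]_n} Gr_openT Gr_openI Gr_open_bigU.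

Definition represents k (A : 'M[R]_(k, n)) (V : {vspace 'rV[R]_n}) : Prop :=
  full_rank A /\ rowspan A = V.

(* [enum_val] lists I in increasing order.  The Plücker coordinates of V are
   the maximal minors of the matrices representing V. *)
Definition plucker k (A : 'M[R]_(k, n)) (I : {set 'I_n}) (cardI : #|I| = k) : R :=
  \det (colsub (fun j : 'I_k => enum_val (cast_ord (esym cardI) j)) A).

Definition Gr_nonneg k : set {vspace 'rV[R]_n} :=
  [set V | exists2 A : 'M[R]_(k, n), represents A V &
     forall (I : {set 'I_n}) (cardI : #|I| = k), 0 <= plucker A cardI].

Definition Gr_pos k : set {vspace 'rV[R]_n} :=
  [set V | exists2 A : 'M[R]_(k, n), represents A V &
     forall (I : {set 'I_n}) (cardI : #|I| = k), 0 < plucker A cardI].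

Definition positroid_cell k (M : {set {set 'I_n}}) : set {vspace 'rV[R]_n} :=
  [set V | Gr_nonneg k V /\
     exists2 A : 'M[R]_(k, n), represents A V &
       forall (I : {set 'I_n}) (cardI : #|I| = k),
         (I \in M -> 0 < plucker A cardI) /\
         (I \notin M -> plucker A cardI = 0)].

Definition orthov (V : {vspace 'rV[R]_n}) : {vspace 'rV[R]_n} :=
  lker (linfun (mulmxr (\matrix_(i < \dim V) (vbasis V)`_i)^T)).

Lemma mem_orthov (V : {vspace 'rV[R]_n}) (v : 'rV[R]_n) :
  v \in orthov V <-> (forall u, u \in V -> \sum_i v 0 i * u 0 i = 0).
Proof.
rewrite memv_ker lfunE /=; split => [/eqP vV u uV|vV].
  have vb (i : 'I_(\dim V)) : \sum_j v 0 j * (vbasis V)`_i 0 j = 0.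
    move/rowP/(_ i): vV; rewrite !mxE => {2}<-.
    by apply: eq_bigr => j _; rewrite !mxE.
  rewrite (coord_vbasis uV).
  under eq_bigr do rewrite summxE mulr_sumr.
  rewrite exchange_big/= big1// => i _.
  under eq_bigr do rewrite mxE mulrCA.
  by rewrite -mulr_sumr vb mulr0.
apply/eqP/rowP => i; rewrite !mxE -[RHS](vV (vbasis V)`_i).
  by apply: eq_bigr => j _; rewrite !mxE.
by apply: vbasis_mem; rewrite mem_nth// size_tuple.
Qed.

End Grassmannian.

(** * Matroids, identified with their sets of bases *)

Definition is_matroid (T : finType) (r : nat) (M : {set {set T}}) : Prop :=
  [/\ M != finset.set0,
      {in M, forall B : {set T}, #|B| = r} &
      {in M &, forall B C : {set T}, forall x, x \in B :\: C ->
         exists2 y, y \in C :\: B & (y |: (B :\ x))%SET \in M}].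

Definition matroid_le (T : finType) (M' M : {set {set T}}) : Prop :=
  M' \subset M.

Definition uniform_matroid (T : finType) (E : {set T}) (r : nat)
    : {set {set T}} :=
  [set B : {set T} | (B \subset E) && (#|B| == r)]%SET.

Definition direct_sum (T : finType) (M N : {set {set T}}) : {set {set T}} :=
  [set B :|: C | B in M, C in N]%SET.

Definition consecutive n (E : {set 'I_n}) : Prop :=
  forall i j l : 'I_n, i \in E -> l \in E -> (i <= j <= l)%N -> j \in E.

(* [set set0], the rank-0 matroid on the empty ground set, is the unit of
   direct sums. *)
Definition interval_matroids n k : set {set {set 'I_n}} :=
  [set M | exists P : {set {set 'I_n}},
     [/\ finset.partition P [set: 'I_n], #|P| = (n - k)%N,
         {in P, forall E, consecutive E} &
         M = \big[@direct_sum _/[set finset.set0]%SET]_(E in P)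
               uniform_matroid E #|E|.-1]].

Definition interval_matroids_closure n k : set {set {set 'I_n}} :=
  [set M' | is_matroid k M' /\
     exists2 M, interval_matroids k M & matroid_le M' M].

(** * Sign vectors *)

Variant sign := SgN | Sg0 | SgP.

Definition bool_of_sign (s : sign) : option bool :=
  match s with SgN => Some false | Sg0 => None | SgP => Some true end.

Definition sign_of_bool (b : option bool) : sign :=
  match b with Some false => SgN | None => Sg0 | Some true => SgP end.

Lemma bool_of_signK : cancel bool_of_sign sign_of_bool.
Proof. by case. Qed.

HB.instance Definition _ := Finite.copy sign (can_type bool_of_signK).

Definition opp_sign (s : sign) : sign :=
  match s with SgN => SgP | Sg0 => Sg0 | SgP => SgN end.

Definition sign_of (R : realType) (x : R) : sign :=
  if x == 0 then Sg0 else if 0 < x then SgP else SgN.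

Notation signvec n := {ffun 'I_n -> sign}.

Definition signv (R : realType) n (v : 'rV[R]_n) : signvec n :=
  [ffun i => sign_of (v 0 i)].

Definition opp_signv n (s : signvec n) : signvec n := [ffun i => opp_sign (s i)].

Definition var n (s : signvec n) : int :=
  if [seq x <- codom s | x != Sg0] is x :: t
  then (count id (pairmap (fun a b => a != b) x t))%:Z else -1.

(* [var] is bounded below by -1, so -1 is a neutral start for the maximum. *)
Definition varbar n (s : signvec n) : int :=
  \big[Order.max/-1]_(t : signvec n | [forall i, (s i != Sg0) ==> (t i == s i)])
    var t.

(** * The m = 1 amplituhedron *)

Section Amplituhedron.
Variables (R : realType) (n k : nat) (W : {vspace 'rV[R]_n}).

Definition phi (V : {vspace 'rV[R]_n}) : {vspace 'rV[R]_n} :=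
  (orthov V :&: W)%VS.

Definition amplituhedron : set {vspace 'rV[R]_n} := phi @` Gr_nonneg k.

Definition amplituhedron_stratum (s : signvec n) : set {vspace 'rV[R]_n} :=
  [set <[w]>%VS | w in [set w : 'rV[R]_n |
     [/\ w \in W, w != 0 & signv w = s \/ signv w = opp_signv s]]].

(* A stratum is the same set for s and - s, so collecting strata as sets
   already takes the sign vectors modulo +-1. *)
Definition amplituhedron_strata : set (set {vspace 'rV[R]_n}) :=
  [set amplituhedron_stratum s | s in [set s : signvec n |
     s != [ffun=> Sg0] /\ varbar s = k%:Z]].

End Amplituhedron.

Definition cells (R : realType) n k : set (set {vspace 'rV[R]_n}) :=
  [set positroid_cell k M | M in interval_matroids_closure k].

Definition cell_union (R : realType) n k : set {vspace 'rV[R]_n} :=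
  \bigcup_(M in interval_matroids_closure k) positroid_cell k M.

(** * Homeomorphisms and poset isomorphisms between subsets *)

Definition homeomorphism_on (T U : topologicalType) (A : set T) (B : set U)
    (f : T -> U) : Prop :=
  [/\ set_bij A B f, {within A, continuous f} &
      exists2 g : U -> T, {in A, cancel f g} & {within B, continuous g}].

Definition poset_on (T : Type) (X : set T) (le : T -> T -> Prop) : Prop :=
  [/\ forall x, X x -> le x x,
      forall x y, X x -> X y -> le x y -> le y x -> x = y &
      forall x y z, X x -> X y -> X z -> le x y -> le y z -> le x z].

Definition poset_isomorphism (T U : Type) (X : set T) (leX : T -> T -> Prop)
    (Y : set U) (leY : U -> U -> Prop) (f : T -> U) : Prop :=
  [/\ poset_on X leX, poset_on Y leY, set_bij X Y f &
      forall x y, X x -> X y -> (leX x y <-> leY (f x) (f y))].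

Definition closure_le (T : topologicalType) (A B : set T) : Prop :=
  closure A `<=` closure B.

Arguments cells : clear implicits.
Arguments cell_union : clear implicits.

(* Main.v *)
Require Import Defs.
From HB Require Import structures.
From mathcomp Require Import all_boot all_order all_algebra.
From mathcomp Require Import all_classical all_reals all_analysis.
From mathcomp Require Import perm zify ring lra.

Set Implicit Arguments.
Unset Strict Implicit.
Unset Printing Implicit Defensive.

Import Order.TTheory GRing.Theory Num.Theory.
Import numFieldNormedType.Exports.

Local Open Scope classical_set_scope.
Local Open Scope ring_scope.

(* Write alt(w)_i = (-1)^i w_i and m = n - k. A vector w orthogonal to a totally
   nonnegative V of dimension k has varbar(w) >= k, and a nonzero w in the
   totally positive W has varbar(w) <= k; hence a nonzero w in V^perp :&: W has
   varbar(w) = k, which means that alt(w) has exactly m runs of constant sign.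
   Two independent such vectors would produce one with an extra run, so
   V^perp :&: W is a line.

   If V lies in a cell of a matroid below an interval matroid, V^perp has a basis
   of m vectors, supported on the m intervals, whose alternations have constant
   sign. A generator w of V^perp :&: W is a combination of them, and since alt(w)
   has m runs, these basis vectors are, up to scalars, the restrictions of w to its
   runs. So V is recovered from w, and conversely any w in W with varbar(w) = k
   gives such a V: this is the inverse of phi_W, it matches cells with sign
   vectors, and it is continuous because the run of an index can only jump where
   w vanishes. The order isomorphism is then a formal consequence of the
   homeomorphism. *)

(** * Alternation of sign sequences *)

(** Both bounds on varbar, the two halves of the Gantmacher-Krein theorem, come from linear
    relations between minors. For W all minors are positive, so an alternating subsequence longer
    than dim W gives a relation whose terms all have the same sign. For V minors may vanish and no
    single relation suffices: the bound is an induction on the length of w. Its steps delete,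
    contract and merge coordinates, so it is stated for an arbitrary nonnegative function [D] on bit
    masks that satisfies the relations. The number m = n - k counts skips: a longest alternating
    subsequence keeps all entries but one per change of run, so its length varbar(w) + 1 is n - (m -
    1). A constant obstacle is that zeros of w belong to no definite run. Labellings [rho] are
    therefore compared only on the support, and the subspace and the matroid attached to w depend on
    [rho] only there. Continuity is tested on matrices: since [rowspan] is open, it suffices to lift
    a map locally to a continuous map of full-rank matrices. *)

Definition bsign (b : bool) : sign := if b then SgN else SgP.

(* The greedy, hence longest, subsequence whose signs weakly alternate
   (a zero counts as either sign), starting from [bsign b]. *)
Fixpoint altlen (b : bool) (l : seq sign) : nat :=
  if l is x :: l' then
    if x == bsign (~~ b) then altlen b l' else (altlen (~~ b) l').+1
  else 0%N.

(** This is varbar + 1: it counts entries instead of sign changes and needs no maximum over the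
    fillings of the zeros. *)
Definition altmax (l : seq sign) : nat := maxn (altlen true l) (altlen false l).

Lemma altmaxE b l : altmax l = maxn (altlen b l) (altlen (~~ b) l).
Proof. by case: b => //=; rewrite /altmax maxnC. Qed.

Lemma altlen_negb b l : (altlen b l <= (altlen (~~ b) l).+1)%N.
Proof.
elim: l b => //= x l IH b; have := IH b; have := IH (~~ b); rewrite negbK.
by case: b; case: x => /=; lia.
Qed.

Lemma altmax_cons x l : (altmax l <= altmax (x :: l))%N.
Proof.
have := altlen_negb true l; have := altlen_negb false l.
by rewrite /altmax; case: x => /=; lia.
Qed.

Lemma altmax_cons0 l : altmax (Sg0 :: l) = (altmax l).+1.
Proof. by rewrite /altmax/=; lia. Qed.

Lemma altlen_nseq0 b p : altlen b (nseq p Sg0) = p.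
Proof. by elim: p b => //= p IH [] /=; rewrite IH. Qed.

(** A virtual previous sign [a], opposite to the first nonzero entry, turns var into the count of
    entries var + 1. *)
Fixpoint changes (a : sign) (l : seq sign) : nat :=
  if l is x :: l' then
    if x == Sg0 then changes a l' else ((a != x) + changes x l')%N
  else 0%N.

Lemma changesE a l :
  changes a l = count id (pairmap (fun a b => a != b) a [seq x <- l | x != Sg0]).
Proof. by elim: l a => //= x l IH a; case: (x == Sg0) => /=; rewrite IH. Qed.

Definition filling (l t : seq sign) : bool :=
  all2 (fun x y => (x != Sg0) ==> (y == x)) l t.

(** The entries where [t] changes sign alternate starting from [bsign b], and the corresponding
    entries of [l] are zero or have the same sign. *)
Lemma changes_le_altlen b l t :
  filling l t -> (changes (bsign (~~ b)) t <= altlen b l)%N.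
Proof.
elim: l t b => [|x l IH] [|y t] b //= /andP[xy lt].
have := IH _ true lt; have := IH _ false lt.
have := altlen_negb true l; have := altlen_negb false l.
by move: xy; case: x; case: y; case: b => //=; lia.
Qed.

Lemma filling_altlen b l :
  exists2 t, filling l t & changes (bsign (~~ b)) t = altlen b l.
Proof.
elim: l b => [|x l IH] b; first by exists [::].
have [t lt tE] := IH b; have [t' lt' tE'] := IH (~~ b).
rewrite negbK in tE'.
have [xb|xb] := eqVneq x (bsign (~~ b)).
  exists (x :: t) => /=; first by rewrite lt eqxx implybT.
  by rewrite xb eqxx -tE; case: (b).
exists (bsign b :: t') => /=.
  by rewrite lt' andbT; move: xb; case: (b); case: (x).
by rewrite (negPf xb) -tE'; case: (b).
Qed.

Lemma changes_var n (s : signvec n) b : (changes (bsign b) (codom s))%:Z <= var s + 1.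
Proof.
rewrite /var changesE; case: [seq x <- _ | _] => [|x t] //=.
by rewrite -PoszD lez_nat addnC leq_add2l leq_b1.
Qed.

Lemma var_head n (s : signvec n) :
  var s = -1 \/ exists b, var s + 1 = (changes (bsign (~~ b)) (codom s))%:Z.
Proof.
rewrite /var; have := fun a => changesE a (codom s).
have : all (fun x => x != Sg0) [seq x <- codom s | x != Sg0].
  by apply/allP => x; rewrite mem_filter => /andP[].
case: [seq x <- _ | _] => [|x t] /=; first by left.
move=> /andP[x0 _] chE; right; exists (x == SgN).
by rewrite chE -PoszD addnC; congr Posz; congr addn; move: x0; case: (x).
Qed.

Lemma filling_codom n (s t : signvec n) :
  filling (codom s) (codom t) = [forall i, (s i != Sg0) ==> (t i == s i)].
Proof.
rewrite /filling all2E !size_map eqxx/= /codom /image_mem.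
rewrite zip_map all_map; apply/allP/forallP => [h i|h i _] /=.
  by apply: h; rewrite mem_enum.
exact: h.
Qed.

Lemma filling_ffun n (s : signvec n) t :
  filling (codom s) t -> exists t' : signvec n, t = codom t'.
Proof.
rewrite /filling all2E => /andP[/eqP st _].
have sz : size t = n by rewrite -st size_codom card_ord.
exists [ffun i : 'I_n => nth Sg0 t i].
apply: (@eq_from_nth _ Sg0); rewrite sz ?size_codom ?card_ord// => i lin.
rewrite codomE.
by rewrite (nth_map (Ordinal lin)) ?size_enum_ord// ffunE nth_enum_ord.
Qed.

Lemma varbar_altmax n (s : signvec n) : varbar s + 1 = (altmax (codom s))%:Z.
Proof.
apply/eqP; rewrite eq_le; apply/andP; split.
  rewrite -lerBrDr; apply/bigmax_leP; split; first by lia.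
  move=> t; rewrite -filling_codom => st.
  have [->|[b tE]] := var_head t; first by lia.
  rewrite lerBrDr tE (altmaxE b) lez_nat leq_max.
  by rewrite changes_le_altlen.
have H b : (altlen b (codom s))%:Z <= varbar s + 1.
  have [t st <-] := filling_altlen b (codom s).
  have [t' tE] := filling_ffun st; rewrite {}tE in st *.
  apply: (le_trans (changes_var _ _)); rewrite lerD2r.
  by apply: (le_bigmax_cond (-1 : int) (fun t => var t)); rewrite -filling_codom.
by rewrite /altmax; case: (leqP (altlen true (codom s)) (altlen false (codom s))) => _; exact: H.
Qed.

(** * Runs of the alternated sequence *)

(* [altbit s i] is the sign of entry i of the vector ((-1)^i s_i)_i. *)
Definition altbit n (s : signvec n) (i : 'I_n) : bool := (s i == SgN) (+) odd i.

Definition labelling n m (rho : 'I_n -> nat) : Prop :=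
  {homo rho : i j / (i <= j)%N} /\ forall i, (rho i < m)%N.

(* The maximal sign-constant runs of ((-1)^i s_i)_i, zeros being ignored, are
   the fibres of [rho] on the support of [s]; [b] is the sign of the first. *)
Definition runs n m (rho : 'I_n -> nat) (b : bool) (s : signvec n) : Prop :=
  [/\ labelling m rho,
      forall i, s i != Sg0 -> altbit s i = b (+) odd (rho i) &
      forall j, (j < m)%N -> exists2 i, rho i = j & s i != Sg0].

(** The form of [runs] that supports induction on lists: [p] is the parity of the position of the
    head in the whole sequence. Only labels above [j0] must be attained on the support, because run
    [j0] may have been opened before the head. *)
Definition list_runs b p j0 j1 (l : seq sign) (r : seq nat) : Prop :=
  [/\ size r = size l, path leq j0 r /\ all (leq^~ j1) r, (j0 <= j1)%N,
      forall t, (t < size l)%N -> nth Sg0 l t != Sg0 ->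
        (nth Sg0 l t == SgN) (+) p (+) odd t = b (+) odd (nth 0%N r t) &
      forall j, (j0 < j <= j1)%N ->
        exists2 t, (t < size l)%N & nth 0%N r t = j /\ nth Sg0 l t != Sg0].

(** Taking an entry flips both the expected sign and the parity of the position, so the expected
    alternated sign changes only at a skip. A skip occurs exactly at the first nonzero entry of each
    label above [j0], hence j1 - j0 times. *)
Lemma list_runs_altlen b p j0 j1 l r : list_runs b p j0 j1 l r ->
  (altlen (b (+) odd j0 (+) p) l + (j1 - j0))%N = size l.
Proof.
elim: l r p j0 => [|x l IH] [|a r] p j0 [] // => [_ _ le01 _ hit|].
  case: (ltngtP j0 j1) le01 => //= [lt01 _|-> _]; last by rewrite subnn.
  by case: (hit j1) => //; rewrite lt01 leqnn.
move=> [sz] /= [/andP[le0a pa] /andP[lea1 al1]] le01 sgn hit.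
have sgn' t : (t < size l)%N -> nth Sg0 l t != Sg0 ->
    (nth Sg0 l t == SgN) (+) (~~ p) (+) odd t = b (+) odd (nth 0%N r t).
  move=> lt lt0; rewrite -(sgn t.+1 lt lt0) /=.
  by case: (nth _ _ _ == _); case: (p); case: (odd t).
have sx : x != Sg0 -> x = bsign (b (+) odd a (+) p).
  move=> x0; have := sgn 0%N isT x0; rewrite /= addbF => h.
  have : (x == SgN) = b (+) odd a (+) p by rewrite -h -addbA addbb addbF.
  by move: x0; case: (x) => //= _ <-.
have [/orP xa|] := boolP ((x == Sg0) || (a == j0)).
  have notN : (x == bsign (~~ (b (+) odd j0 (+) p))) = false.
    case: xa => [/eqP-> |/eqP aj]; first by case: (b (+) odd j0 (+) p).
    have [->|/sx ->] := eqVneq x Sg0; first by case: (b (+) odd j0 (+) p).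
    by rewrite aj; case: (b (+) odd j0 (+) p).
  rewrite notN; have <- := IH r (~~ p) j0; last first.
    split=> //; first by split=> //; apply: path_le pa => //; exact: leq_trans.
    move=> j jb; have [[|t] lt [ej ej0]] := hit _ jb; last by exists t.
    by case: xa => [/eqP xE|/eqP aE]; move: ej ej0 jb => /= <-; rewrite ?xE ?aE ?ltnn.
  by rewrite addbN.
rewrite negb_or => /andP[x0 ja].
have lt0a : (j0 < a)%N by rewrite ltn_neqAle eq_sym ja.
(* Labels cannot jump: j0 + 1 is attained on the support, and the labels from the head on are at
   least [a]. *)
have aE : a = j0.+1.
  apply/eqP; rewrite eqn_leq lt0a andbT.
  have [|[|t] lt [/= ej _]] := hit j0.+1; first by lia.
    by rewrite ej.
  rewrite -ej; have := order_path_min leq_trans pa.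
  by move=> /allP; apply; apply: mem_nth; rewrite sz.
rewrite (sx x0) aE /= !addbN !addNb eqxx.
have := IH r (~~ p) j0.+1; rewrite /= !addbN !addNb negbK => IH'.
rewrite -[in RHS]IH'; first by move: lea1; lia.
split=> //; first by split=> //; rewrite -aE.
  by rewrite -aE.
move=> j jb; have [|[|t] lt [ej ej0]] := hit j; first by lia.
  by move: ej jb => /= <-; rewrite aE ltnn.
by exists t.
Qed.

Lemma list_runs_ex b p j0 l : exists r j1, list_runs b p j0 j1 l r.
Proof.
elim: l p j0 => [|x l IH] p j0.
  by exists [::], j0; split => // j; lia.
have [/orP xa|] := boolP ((x == Sg0) || (x == bsign (b (+) odd j0 (+) p))).
  have [r [j1 [sz [pr al] le01 sgn hit]]] := IH (~~ p) j0.
  exists (j0 :: r), j1; split => //=; rewrite ?sz ?leqnn ?le01//.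
    move=> [|t] lt; last first.
      move=> /(sgn _ lt) <- /=.
      by case: (nth _ _ _ == _); case: (p); case: (odd t).
    case: xa => /= /eqP -> //= _; rewrite addbF.
    by case: (b); case: (odd j0); case: (p).
  by move=> j /hit[t lt h]; exists t.+1.
rewrite negb_or => /andP[x0 xN].
have [r [j1 [sz [pr al] le01 sgn hit]]] := IH (~~ p) j0.+1.
exists (j0.+1 :: r), j1; split => //=; rewrite ?sz ?leqnn ?le01 ?(ltnW le01)//.
- by rewrite leqnSn.
- move=> [|t] lt; last first.
    move=> /(sgn _ lt) <- /=.
      by case: (nth _ _ _ == _); case: (p); case: (odd t).
  rewrite /= => _; rewrite addbF; move: x0 xN.
  by case: (b); case: (odd j0); case: (p); case: (x).
- move=> j jb; have [->|jn] := eqVneq j j0.+1; first by exists 0%N.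
  by have [|t lt h] := hit j; [lia|exists t.+1].
Qed.

Lemma nth_codom_ord (T : Type) (x0 : T) n (f : 'I_n -> T) (i : 'I_n) :
  nth x0 (codom f) i = f i.
Proof. by rewrite codomE (nth_map i) ?size_enum_ord// nth_ord_enum. Qed.

(** These are the two starting signs of [altmax]. Started from the sign opposite to the first run,
    the greedy subsequence behaves as if an empty run came first, whence the shift [S \o rho] and
    one more skip. *)
Lemma runs_list_runs n m rho b (s : signvec n) : runs m rho b s -> (0 < m)%N ->
  list_runs b false 0 m.-1 (codom s) (codom rho) /\
  list_runs (~~ b) false 0 m (codom s) (codom (S \o rho)).
Proof.
move=> [[homo ltm] sgn hit] m0.
have srt (f : 'I_n -> nat) : {homo f : i j / (i <= j)%N} -> path leq 0 (codom f).
  move=> hf; rewrite path_min_sorted; last exact/allP.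
  rewrite codomE; apply: (homo_sorted (e := fun i j : 'I_n => (i <= j)%N)) => //.
  by have := iota_sorted 0 n; rewrite -val_enum_ord sorted_map.
have aP (f : 'I_n -> nat) (c : nat) : (forall i, (f i <= c)%N) -> all (leq^~ c) (codom f).
  by move=> fc; apply/allP => _ /codomP[i ->].
split; split => //; rewrite ?size_codom//.
- by split; [exact: srt|apply: aP => i; rewrite -ltnS prednK].
- move=> t; rewrite card_ord => lt.
  have := nth_codom_ord Sg0 s (Ordinal lt); have := nth_codom_ord 0%N rho (Ordinal lt).
  by move=> /= -> -> /sgn; rewrite /altbit /= addbF.
- move=> j jm; have [|i ri si] := hit j; first by lia.
  by exists i; rewrite ?card_ord// !nth_codom_ord.
- split; last by apply: aP => i /=.
  by apply: srt => i j ij /=; rewrite ltnS homo.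
- move=> t; rewrite card_ord => lt.
  have := nth_codom_ord Sg0 s (Ordinal lt).
  have := nth_codom_ord 0%N (S \o rho) (Ordinal lt).
  by move=> /= -> -> /sgn; rewrite /altbit /= addbF addbN addNb negbK.
- move=> j jm; have [|i ri si] := hit j.-1; first by lia.
  by exists i; rewrite ?card_ord// !nth_codom_ord /= ri; split=> //; lia.
Qed.

Lemma runs_altmax n m rho b (s : signvec n) : runs m rho b s -> (0 < m)%N ->
  (altmax (codom s) + m)%N = n.+1.
Proof.
move=> /runs_list_runs rl m0.
have [/list_runs_altlen h1 /list_runs_altlen h2] := rl m0.
move: h1 h2; rewrite !addbF size_codom card_ord (altmaxE b) !subn0 => h1 h2.
by move: m0 h1 h2; lia.
Qed.

Lemma runs_ex n (s : signvec n) : s != [ffun=> Sg0] ->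
  exists m rho b, (0 < m)%N /\ runs m rho b s.
Proof.
move=> s0.
have /existsP[i1 si1] : [exists i, s i != Sg0].
  apply: contraR s0; rewrite negb_exists => /forallP s0.
  by apply/eqP/ffunP => i; rewrite ffunE; apply/eqP; rewrite -[_ == _]negbK.
case: (arg_minnP (P := fun i => s i != Sg0) (@nat_of_ord n) si1) => i0 si0 mini.
(* Starting from the sign opposite to the first nonzero entry leaves label 0 without support, so the
   supported labels are exactly 1, ..., j1; [predn] then shifts them down. *)
have [r [j1 [sz [pr al] _ sgn hit]]] := list_runs_ex (~~ altbit s i0) false 0 (codom s).
have [szn size_r] : size (codom s) = n /\ size r = n by rewrite sz size_codom card_ord.
pose rho (i : 'I_n) := nth 0%N r i.
have homo : {homo rho : i j / (i <= j)%N}.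
  move=> i j ij; apply: (sorted_leq_nth leq_trans leqnn) => //.
  - exact: path_sorted pr.
  - by rewrite inE size_r.
  - by rewrite inE size_r.
have le1 i : (rho i <= j1)%N by apply: (allP al); rewrite mem_nth// size_r.
have sg i : s i != Sg0 -> altbit s i = ~~ altbit s i0 (+) odd (rho i).
  move=> si; have := sgn i; rewrite szn nth_codom_ord => /(_ (ltn_ord i) si) <-.
  by rewrite addbF.
have pos i : s i != Sg0 -> (0 < rho i)%N.
  move=> si; apply: leq_trans (homo _ _ (mini _ si)).
  by have := sg _ si0; case: (rho i0) => //=; case: (altbit s i0).
have j1p : (0 < j1)%N := leq_trans (pos _ si0) (le1 _).
exists j1, (predn \o rho), (altbit s i0); split=> //; split.
- split=> [i j ij /=|i /=]; first by have := homo _ _ ij; lia.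
  by have := le1 i; lia.
- move=> i si; rewrite (sg _ si) /=; have := pos _ si; case: (rho i) => //= p _.
  by rewrite addNb addbN negbK.
- move=> j jm; have [|t] := hit j.+1; first by lia.
  rewrite szn => lt; have := nth_codom_ord Sg0 s (Ordinal lt) => /= -> [rt st].
  by exists (Ordinal lt) => //=; rewrite /rho/= rt.
Qed.

Lemma runs_varbar n k rho b (s : signvec n) : (k < n)%N ->
  runs (n - k) rho b s -> varbar s = k%:Z.
Proof.
move=> kn rs; have := runs_altmax rs; rewrite subn_gt0 => /(_ kn) h.
have := varbar_altmax s; move: kn h; lia.
Qed.

Lemma altmax_runs n k (s : signvec n) : s != [ffun=> Sg0] ->
  altmax (codom s) = k.+1 -> exists rho b, runs (n - k) rho b s.
Proof.
move=> /runs_ex[m [rho [b [m0 rs]]]] h; exists rho, b.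
by have := runs_altmax rs m0; rewrite h => e; have -> : (n - k = m)%N by lia.
Qed.

(** By monotonicity consecutive distinct labels increase strictly, and there is only one strictly
    increasing sequence of m numbers below m. *)
Lemma label_alternating n m rho (r : 'I_m -> 'I_n) : labelling m rho ->
  {homo r : i j / (i < j)%N} ->
  (forall i j : 'I_m, j = i.+1 :> nat -> rho (r i) != rho (r j)) ->
  forall j, rho (r j) = j.
Proof.
move=> [homo ltm] hr alt.
have step (i j : 'I_m) : j = i.+1 :> nat -> (rho (r i) < rho (r j))%N.
  move=> ij; rewrite ltn_neqAle alt// homo// ltnW// hr//; lia.
have lo p (j : 'I_m) : j = p :> nat -> (p <= rho (r j))%N.
  elim: p j => // p IH j jp; have pm : (p < m)%N by have := ltn_ord j; lia.
  by have := IH (Ordinal pm) erefl; have := step (Ordinal pm) j jp; lia.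
have hi p (j : 'I_m) : (j + p).+1 = m -> (rho (r j) <= j)%N.
  elim: p j => [|p IH] j jp; first by have := ltm (r j); lia.
  have pm : (j.+1 < m)%N by lia.
  by have := IH (Ordinal pm); have := step j (Ordinal pm) erefl; move=> /=; lia.
move=> j; apply/eqP; rewrite eqn_leq (hi (m - j.+1)%N) ?lo//.
by have := ltn_ord j; lia.
Qed.

Lemma no_long_alternating n m rho (r : 'I_m.+1 -> 'I_n) : labelling m rho ->
  {homo r : i j / (i < j)%N} ->
  (forall i j : 'I_m.+1, j = i.+1 :> nat -> rho (r i) != rho (r j)) -> False.
Proof.
move=> [homo ltm] hr alt.
have lab : labelling m.+1 rho by split=> // i; apply: ltnW; rewrite ltnS.
have := @label_alternating n m.+1 rho r lab hr alt ord_max.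
by have := ltm (r ord_max); rewrite /=; lia.
Qed.

Lemma runs_reps n m rho b (s : signvec n) : runs m rho b s ->
  exists2 r : 'I_m -> 'I_n, forall j, rho (r j) = j /\ s (r j) != Sg0 &
    {homo r : i j / (i < j)%N}.
Proof.
move=> [[homo _] _ hit].
have /choice[r hr] : forall j : 'I_m, exists i, rho i = j /\ s i != Sg0.
  by move=> j; have [i] := hit j (ltn_ord j); exists i.
exists r => // i j ij; rewrite ltnNge; apply/negP => /homo.
by rewrite (hr i).1 (hr j).1; lia.
Qed.

Lemma runs_label_rep n m rho b (s : signvec n) (r : 'I_m -> 'I_n) c : runs m rho b s ->
  {homo r : i j / (i < j)%N} -> (forall j, s (r j) != Sg0) ->
  (forall j, altbit s (r j) = c (+) odd j) -> forall j, rho (r j) = j.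
Proof.
move=> [lab sgn _] hr sr altr; apply: label_alternating => // i j ij.
apply/eqP => eij; have := altr j; rewrite sgn// -eij -sgn// altr ij /=.
by case: (c); case: (odd i).
Qed.

(** A choice of one supported index per run can be made to pass through [i]. Its consecutive entries
    have opposite alternated signs, hence distinct [rho']-labels, and [label_alternating] determines
    these. *)
Lemma runs_uniq n m rho b (s : signvec n) rho' : runs m rho b s -> labelling m rho' ->
  (forall i j, s i != Sg0 -> s j != Sg0 -> rho' i = rho' j -> altbit s i = altbit s j) ->
  forall i, s i != Sg0 -> rho' i = rho i.
Proof.
move=> rs lab' cst i si; have [r hr _] := runs_reps rs; have [[homo ltm] sgn _] := rs.
pose r' (j : 'I_m) := if j == rho i :> nat then i else r j.
have hr' j : rho (r' j) = j /\ s (r' j) != Sg0.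
  by rewrite /r'; case: eqVneq => [->|_].
have := @label_alternating n m rho' r' lab' _ _ (Ordinal (ltm i)).
rewrite /r' /= eqxx => -> //.
- move=> p q pq; rewrite ltnNge; apply/negP => /homo.
  by rewrite (hr' p).1 (hr' q).1; lia.
- move=> p q pq; apply/eqP => /(cst _ _ (hr' p).2 (hr' q).2).
  rewrite !sgn ?(hr' p).2 ?(hr' q).2// (hr' p).1 (hr' q).1 pq /=.
  by case: (b); case: (odd p).
Qed.

Lemma runs_relabel n m rho b (s : signvec n) rho' : runs m rho b s -> labelling m rho' ->
  (forall i, s i != Sg0 -> rho' i = rho i) -> runs m rho' b s.
Proof.
move=> [_ sgn hit] lab' e; split=> // [i si|j /hit[i ri si]].
  by rewrite e// sgn.
by exists i; rewrite ?e.
Qed.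

(** * Sign variation from linear relations between minors *)

Section Relations.
Variable R : realType.
Implicit Types (w : seq R) (D : seq bool -> R).

Definition signs w : seq sign := map (@sign_of R) w.

(* With bit masks for subsets, the sum over i outside K of
   (-1)^#{x in K | x < i} w_i D(K u {i}). *)
Fixpoint extension_sum w (K : seq bool) D : R :=
  match w, K with
  | x :: w', b :: K' =>
      if b then - extension_sum w' K' (fun I => D (true :: I))
      else x * D (true :: K') + extension_sum w' K' (fun I => D (false :: I))
  | _, _ => 0
  end.

(* The sum over i in J of (-1)^#{x in J | x < i} w_i D(J \ {i}). *)
Fixpoint deletion_sum w (J : seq bool) D : R :=
  match w, J with
  | x :: w', b :: J' =>
      if b then x * D (false :: J') - deletion_sum w' J' (fun I => D (true :: I))
      else deletion_sum w' J' (fun I => D (false :: I))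
  | _, _ => 0
  end.

Lemma extension_sumD w K D1 D2 a :
  extension_sum w K (fun I => D1 I + a * D2 I) =
  extension_sum w K D1 + a * extension_sum w K D2.
Proof.
elim: w K D1 D2 => [|x w IH] [|[] K] D1 D2 /=; rewrite ?mulr0 ?addr0//.
  by rewrite IH; ring.
by rewrite IH; ring.
Qed.

Lemma extension_sum_eq0 w K D : size K = size w ->
  (forall I, size I = size w -> count id I = (count id K).+1 -> D I = 0) ->
  extension_sum w K D = 0.
Proof.
elim: w K D => [|x w IH] [|b K] D //= [sz] D0; case: b D0 => D0.
  by rewrite IH ?oppr0// => I sI cI; apply: D0 => /=; [rewrite sI|rewrite cI].
have -> : D (true :: K) = 0 by apply: D0; rewrite /= ?sz.
rewrite mulr0 add0r IH// => I sI cI.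
by apply: D0 => /=; [rewrite sI|rewrite cI].
Qed.

Lemma sign_of0 : sign_of (0 : R) = Sg0.
Proof. by rewrite /sign_of eqxx. Qed.

Lemma sign_of_gt0 (x : R) : 0 < x -> sign_of x = SgP.
Proof. by move=> x0; rewrite /sign_of (gt_eqF x0) x0. Qed.

Lemma sign_of_lt0 (x : R) : x < 0 -> sign_of x = SgN.
Proof. by move=> x0; rewrite /sign_of (lt_eqF x0) ltNge (ltW x0). Qed.

Lemma sign_of_eq0 (x : R) : (sign_of x == Sg0) = (x == 0).
Proof. by rewrite /sign_of; case: (x == 0) => //; case: (0 < x). Qed.

Lemma sign_of_bsign (x : R) b : sign_of x = bsign b -> 0 < (-1) ^+ b * x.
Proof.
rewrite /sign_of; have [xp|xn|x0] := ltrgt0P x; case: b => //= _.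
  by rewrite expr0 mul1r.
by rewrite expr1 mulN1r oppr_gt0.
Qed.

Lemma signs_zero w : all (pred1 0) w -> signs w = nseq (size w) Sg0.
Proof.
by elim: w => //= x w IH /andP[/eqP-> /IH]; rewrite /signs /= sign_of0 => ->.
Qed.

(* Induction on w = x :: y :: _, in matroid terms: delete x if it is a loop,
   contract it if x = 0 or x y < 0, merge x and y if x y > 0, and delete or
   contract y if y = 0; each step keeps the hypotheses on D. *)
Lemma extension_sum_altmax w k D :
  (forall I, size I = size w -> count id I = k -> 0 <= D I) ->
  (exists I, [/\ size I = size w, count id I = k & D I != 0]) ->
  (forall K, size K = size w -> (count id K).+1 = k -> extension_sum w K D = 0) ->
  has (predC1 0) w -> (k < altmax (signs w))%N.
Proof.
have [N] := ubnP (size w); elim: N w k D => // N IH [|x w] k D //=.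
rewrite ltnS => ltN D0 [I0 [szI cI DI]] rel nz.
(* Contraction of [x]: the masks containing [x] satisfy the same relations, up to a global sign,
   with k - 1 in place of k. *)
have step1 : (exists I, [/\ size I = size w, (count id I).+1 = k & D (true :: I) != 0]) ->
    has (predC1 0) w -> (k <= altmax (signs w))%N.
  case: k D0 cI rel => [|k] D0 cI rel [I [sI cI' DI']] nzw; first by [].
  apply: (IH w k (fun I => D (true :: I))) => //.
  - by move=> I' sI' cI''; apply: D0 => /=; [rewrite sI'|lia].
  - by exists I; split=> //; case: cI'.
  - move=> K sK cK; apply: oppr_inj; rewrite oppr0.
    by have /= := rel (true :: K); apply; [rewrite sK|lia].
have [ex1|nex1] := pselect
    (exists I, [/\ size I = size w, (count id I).+1 = k & D (true :: I) != 0]);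
  last first.
  have loop I : size I = size w -> (count id I).+1 = k -> D (true :: I) = 0.
    by move=> sI cI'; apply/eqP/negPn/negP => DI'; apply: nex1; exists I.
  case: I0 szI cI DI => // -[] I0 [szI] /= cI DI.
    by move: DI; rewrite loop ?eqxx// -cI.
  have [nzw|/hasPn zw] := boolP (has (predC1 0) w).
    apply: leq_trans (altmax_cons _ _).
    apply: (IH w k (fun I => D (false :: I))) => //.
    - by move=> I' sI' cI'; apply: D0 => /=; [rewrite sI'|].
    - by exists I0.
    - move=> K sK cK; have /= := rel (false :: K).
      by rewrite loop// mulr0 add0r => -> //; rewrite sK.
  (* Only [x] is nonzero. The zeros extend any alternation, so [altmax] is the full length, which
     exceeds k because some mask of weight k avoids [x]. *)
  have zw' : all (pred1 0) w by apply/allP => y /zw; rewrite /= negbK.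
  have x0 : x != 0 by move: nz => /=; case/orP => // /hasP[y /zw]; rewrite /= => /negbTE->.
  have kw : (k <= size w)%N by rewrite -cI -szI count_size.
  rewrite /signs /= -/(signs w) signs_zero//.
  move: kw; set p := size w => kw; have := altlen_nseq0 true p; have := altlen_nseq0 false p.
  by rewrite /altmax /= -(sign_of_eq0 x) in x0 *; move: x0; case: (sign_of x) => //= _; lia.
have {}step1 := step1 ex1.
have [x0|x0] := eqVneq x 0.
  have nzw : has (predC1 0) w by move: nz => /=; rewrite x0 /= eqxx.
  by rewrite /signs /= x0 sign_of0 altmax_cons0 ltnS step1.
case: w => [|y w] in ltN D0 szI rel nz ex1 step1 *.
  case: ex1 => -[|b I] [] // _ k1 /negP[]; apply/eqP.
  have /= := rel [:: false] erefl k1; rewrite addr0 => /eqP.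
  by rewrite mulf_eq0 (negPf x0) => /eqP.
have [xy|xy|xy] := ltrgt0P (x * y).
- have yx : 0 < y / x.
    have -> : y / x = x * y / x ^+ 2 by field.
    by rewrite divr_gt0// exprn_even_gt0.
  have sxy : sign_of y = sign_of x.
    have [xp|xn|x00] := ltrgt0P x; last by rewrite x00 eqxx in x0.
      by rewrite !sign_of_gt0//; move: xy; rewrite pmulr_rgt0.
    by rewrite !sign_of_lt0//; move: xy; rewrite nmulr_rgt0.
  have -> : altmax (signs (x :: y :: w)) = altmax (signs (x :: w)).
    rewrite /signs /= sxy /altmax; have [xp|xn|x00] := ltrgt0P x.
    - by rewrite sign_of_gt0.
    - by rewrite sign_of_lt0.
    - by rewrite x00 eqxx in x0.
  (* With this weight x D(I u {x}) + y D(I u {y}) is x times the merged value. Masks containing both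
     coordinates are dropped: their terms in the relations at K u {x} and K u {y} cancel with the
     factor y / x. *)
  pose D' I := if I is b :: I' then
     if b then D (true :: false :: I') + y / x * D (false :: true :: I')
     else D (false :: false :: I') else 0.
  have Dtf0 I : size I = size w -> (count id I).+1 = k -> 0 <= D (true :: false :: I).
    by move=> sI cI'; apply: D0 => /=; [rewrite sI|lia].
  have Dft0 I : size I = size w -> (count id I).+1 = k -> 0 <= D (false :: true :: I).
    by move=> sI cI'; apply: D0 => /=; [rewrite sI|lia].
  apply: (IH (x :: w) k D') => //=.
  + move=> [|[] I] //= [sI] cI'; last by apply: D0 => /=; [rewrite sI|].
    by apply: addr_ge0; [exact: Dtf0|apply: mulr_ge0; [exact: ltW|exact: Dft0]].
  + apply: contrapT => nex.
    have all0 I : size I = (size w).+1 -> count id I = k -> D' I = 0.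
      by move=> sI cI'; apply/eqP/negPn/negP => DI'; apply: nex; exists I.
    have Dff I : size I = size w -> count id I = k -> D (false :: false :: I) = 0.
      by move=> sI cI'; apply: (all0 (false :: I)) => /=; rewrite ?sI.
    have Dtf_ft I : size I = size w -> (count id I).+1 = k ->
        D (true :: false :: I) = 0 /\ D (false :: true :: I) = 0.
      move=> sI cI'; have /= /eqP := all0 (true :: I) (congr1 S sI) cI'.
      rewrite paddr_eq0; [|exact: Dtf0|by apply: mulr_ge0; [exact: ltW|exact: Dft0]].
      by rewrite mulf_eq0 (gt_eqF yx) /= => /andP[/eqP-> /eqP->].
    (* Once the masks with exactly one of the two coordinates are excluded, the relation at {x} u I
       reduces to the term y D({x, y} u I). *)
    have Dtt I : size I = size w -> (count id I).+2 = k -> D (true :: true :: I) = 0.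
      move=> sI cI'; have /= := rel [:: true, false & I].
      rewrite (@extension_sum_eq0 w I) => // [/(_ _ _)/eqP|I' sI' cI''].
        rewrite addr0 oppr_eq0 mulf_eq0 => h.
        have /orP[/eqP y0|/eqP//] : (y == 0) || (D [:: true, true & I] == 0).
          by apply: h => /=; rewrite ?sI// -cI'; lia.
        by move: xy; rewrite y0 mulr0 ltxx.
      by apply: (Dtf_ft _ _ _).1 => //; rewrite cI''.
    case: (I0) szI cI DI => [//|c [//|d I]] /= [sI] cI' /negP; apply; apply/eqP.
    move: c d cI' => [] [] /= cI'.
    * by apply: Dtt => //; rewrite -cI'; lia.
    * by apply: (Dtf_ft _ _ _).1 => //; rewrite -cI'; lia.
    * by apply: (Dtf_ft _ _ _).2 => //; rewrite -cI'; lia.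
    * exact: Dff.
  + move=> [|[] K] //= [sK] cK.
      rewrite extension_sumD.
      have /= := rel [:: true, false & K]; have /= := rel [:: false, true & K].
      rewrite sK => /(_ erefl) h1 /(_ erefl) h2.
      have {}h1 := h1 ltac:(by rewrite -cK; lia).
      have {}h2 := h2 ltac:(by rewrite -cK; lia).
      set a := extension_sum w K _ in h1 *; set c := extension_sum w K _ in h2 *.
      have -> : a = x * D [:: true, true & K] by lra.
      have -> : c = - (y * D [:: true, true & K]) by lra.
      by field.
    have /= := rel [:: false, false & K]; rewrite sK => /(_ erefl) h1.
    rewrite -[RHS]h1//; by field.
  + by rewrite x0.
- have y0 : y != 0 by apply: contraTneq xy => ->; rewrite mulr0 ltxx.
  have := step1; rewrite /= y0 => /(_ isT); rewrite /signs/= -/(signs w).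
  rewrite /altmax; have [xp|xn|x00] := ltrgt0P x; last by rewrite x00 eqxx in x0.
    have yn : y < 0 by move: xy; rewrite pmulr_rlt0.
    by rewrite (sign_of_gt0 xp) (sign_of_lt0 yn) /=; lia.
  have yn : 0 < y by move: xy; rewrite nmulr_rlt0.
  by rewrite (sign_of_lt0 xn) (sign_of_gt0 yn) /=; lia.
- move/eqP: xy; rewrite mulf_eq0 (negPf x0) /= => /eqP y0.
  have altE : altmax (signs (x :: y :: w)) = (altmax (signs (- x :: w))).+1 /\
              (altmax (signs (x :: w)) <= altmax (signs (x :: y :: w)))%N.
    rewrite /signs /= y0 sign_of0 -/(signs w) /altmax.
    have := altlen_negb true (signs w); have := altlen_negb false (signs w).
    have [xp|xn|x00] := ltrgt0P x; last by rewrite x00 eqxx in x0.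
      by rewrite sign_of_gt0// sign_of_lt0 ?oppr_lt0//=; lia.
    by rewrite sign_of_lt0// sign_of_gt0 ?oppr_gt0//=; lia.
  have [[b [I [sI cI' DI']]]|nex] := pselect (exists (b : bool) I,
      [/\ size I = size w, (b + (count id I)).+1 = k & D [:: b, true & I] != 0]).
    case: k => [//|k] in D0 cI rel cI' step1 ex1 *.
    rewrite altE.1 ltnS.
    (* Contracting [y] flips the sign of every later term but not that of [x], which comes before
       it; up to a global sign, [x] becomes [- x]. *)
    apply: (IH (- x :: w) k
      (fun I => if I is b :: I' then D [:: b, true & I'] else 0)) => //=.
    + by move=> [//|c I'] /= [sI'] cI''; apply: D0 => /=; [rewrite sI'|lia].
    + by exists (b :: I); split=> //=; [rewrite sI|lia].
    + move=> [|[] K] //= [sK] cK.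
        have /= := rel [:: true, true & K]; rewrite sK opprK => -> //; last by lia.
        by rewrite oppr0.
      have /= := rel [:: false, true & K]; rewrite sK => h.
      by rewrite mulNr -[LHS]opprK opprD opprK h ?oppr0//; lia.
    + by rewrite oppr_eq0 x0.
  have loop (b : bool) I : size I = size w -> (b + (count id I)).+1 = k -> D [:: b, true & I] = 0.
    by move=> sI cI'; apply/eqP/negPn/negP => DI'; apply: nex; exists b, I.
  apply: leq_trans altE.2.
  apply: (IH (x :: w) k
    (fun I => if I is b :: I' then D [:: b, false & I'] else 0)) => //=.
  + by move=> [//|c I'] /= [sI'] cI''; apply: D0 => /=; [rewrite sI'|lia].
  + case: (I0) szI cI DI => [//|c [//|d I]] /= [sI] cI' DI.
    case: d => /= in cI' DI; first by move: DI; rewrite loop ?eqxx//; lia.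
    by exists (c :: I); split=> //=; rewrite ?sI//; lia.
  + move=> [|[] K] //= [sK] cK.
      have /= := rel [:: true, false & K]; rewrite sK y0 mul0r add0r; apply=> //; lia.
    have /= := rel [:: false, false & K]; rewrite sK y0 mul0r add0r; apply=> //; lia.
  + by rewrite x0.
Qed.

(** A vector of a generic r-dimensional space with r zeros is zero. If the entries after [x] have r
    zeros they all vanish by induction, and the relation at [x] and r further entries isolates x
    times a positive number; otherwise x = 0 and it is contracted. *)
Lemma deletion_sum_zeros w r D :
  (forall I, size I = size w -> count id I = r -> 0 < D I) ->
  (forall J, size J = size w -> count id J = r.+1 -> deletion_sum w J D = 0) ->
  (r <= count (pred1 0%R) w)%N -> all (pred1 0) w.
Proof.
elim: w r D => [//|x w IH] r D D0 rel /=.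
have D0f I : size I = size w -> count id I = r -> 0 < D (false :: I).
  by move=> sI cI; apply: D0 => //=; rewrite sI.
have relf J : size J = size w -> count id J = r.+1 ->
    deletion_sum w J (fun I => D (false :: I)) = 0.
  by move=> sJ cJ; apply: (rel (false :: J)) => //=; rewrite sJ.
have [x0|x0] := eqVneq x 0; last first.
  rewrite add0n => rw; exfalso; have w0 := IH r _ D0f relf rw.
  have rs : (r <= size w)%N := leq_trans rw (count_size _ _).
  pose J := nseq r true ++ nseq (size w - r) false.
  have sJ : size J = size w by rewrite size_cat !size_nseq subnKC.
  have cJ : count id J = r by rewrite count_cat !count_nseq /= mul1n mul0n addn0.
  have del0 w' J' D' : all (pred1 0) w' -> deletion_sum w' J' D' = 0.
    elim: w' J' D' => [|y w' IHw] [|[] J'] D' //= /andP[/eqP y0 w'0]; last exact: IHw.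
    by rewrite y0 mul0r sub0r IHw ?oppr0.
  have /= := rel (true :: J); rewrite sJ cJ => /(_ erefl erefl) /eqP.
  by rewrite del0// subr0 mulf_eq0 (negPf x0) /= gt_eqF// D0f.
case: r => [|r] in D0 rel D0f relf *; first by move=> _; apply: (IH 0%N _ D0f).
rewrite add1n ltnS => rw; apply: (IH r (fun I => D (true :: I))) => // I sI cI.
  by apply: D0 => /=; [rewrite sI|lia].
have /= := rel (true :: I); rewrite x0 mul0r sub0r => h.
by apply: oppr_inj; rewrite oppr0 h// ?sI//; lia.
Qed.

(** [J] is the greedy alternating subsequence. The sign in the deletion sum cancels the alternation,
    so every term has sign (-1)^b or is zero, and the sum vanishes only if [w] vanishes on [J]. *)
Lemma altlen_deletion_sum w b L : (L <= altlen b (signs w))%N ->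
  exists J, [/\ size J = size w, count id J = L & forall D,
    (forall I, size I = size w -> (count id I).+1 = L -> 0 < D I) ->
    0 <= (-1) ^+ b * deletion_sum w J D /\
    (deletion_sum w J D = 0 -> (L <= count (pred1 0%R) w)%N)].
Proof.
elim: w b L => [|x w IH] b L /=.
  by rewrite leqn0 => /eqP ->; exists [::]; split=> // D _; rewrite mulr0.
have [xb|xb] := eqVneq (sign_of x) (bsign (~~ b)).
  move=> /IH[J [sJ cJ h]]; exists (false :: J); split=> //=; first by rewrite sJ.
  move=> D D0; have [|h1 h2] := h (fun I => D (false :: I)).
    by move=> I sI cI; apply: D0 => //=; rewrite sI.
  by split=> // /h2/leq_trans -> //; exact: leq_addl.
case: L => [_|L].
  exists (nseq (size w).+1 false); split; rewrite ?size_nseq ?count_nseq//= => D _.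
  suff del0 w' D' : deletion_sum w' (nseq (size w') false) D' = 0.
    by rewrite del0 mulr0.
  by elim: w' D' => //= y w' IHw D'.
rewrite ltnS => /IH[J [sJ cJ h]]; exists (true :: J); split=> //=.
- by rewrite sJ.
- by rewrite cJ.
move=> D D0; have [|h1 h2] := h (fun I => D (true :: I)).
  by move=> I sI cI; apply: D0 => /=; [rewrite sI|lia].
have DJ : 0 < D (false :: J) by apply: D0; rewrite /= ?sJ ?cJ.
have xb0 : 0 <= (-1) ^+ b * x.
  have [/eqP|/sign_of_bsign/ltW//] : sign_of x = Sg0 \/ sign_of x = bsign b.
    by move: xb; case: (b); case: (sign_of x); auto.
  by rewrite sign_of_eq0 => /eqP ->; rewrite mulr0.
set d := deletion_sum w J _ in h1 h2 *.
have dE : (-1) ^+ (~~ b) * d = - ((-1) ^+ b * d).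
  by case: (b); rewrite /= ?expr1 ?expr0 ?mulN1r ?mul1r ?opprK.
rewrite dE oppr_ge0 in h1.
have t1 : 0 <= (-1) ^+ b * (x * D (false :: J)) by rewrite mulrA mulr_ge0// ltW.
split; first by rewrite mulrBr subr_ge0 (le_trans h1).
move=> e; have e' : (-1) ^+ b * (x * D (false :: J)) - (-1) ^+ b * d = 0.
  by rewrite -mulrBr e mulr0.
have d0 : (-1) ^+ b * d = 0 by lra.
have x0 : (-1) ^+ b * (x * D (false :: J)) = 0 by lra.
have {}d0 : d = 0 by apply/eqP; move/eqP: d0; rewrite mulf_eq0 signr_eq0.
have {}x0 : x = 0.
  by apply/eqP; move/eqP: x0; rewrite !mulf_eq0 signr_eq0 (gt_eqF DJ) orbF.
by rewrite x0 eqxx add1n ltnS; exact: h2.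
Qed.

Lemma deletion_sum_altmax w r D :
  (forall I, size I = size w -> count id I = r -> 0 < D I) ->
  (forall J, size J = size w -> count id J = r.+1 -> deletion_sum w J D = 0) ->
  has (predC1 0) w -> (altmax (signs w) <= r)%N.
Proof.
move=> D0 rel nz; suff H b : (altlen b (signs w) <= r)%N by rewrite geq_max !H.
rewrite leqNgt; apply/negP => /altlen_deletion_sum[J [sJ cJ h]].
have [|_ /(_ (rel _ sJ cJ)) z] := h D; first by move=> I sI [] /D0->.
have /allP w0 := deletion_sum_zeros D0 rel (ltnW z).
by case/hasP: nz => x /w0 /= ->.
Qed.
End Relations.

(** * Minors *)

Section RowDeterminant.
Variables (R : realType) (r : nat).
Implicit Types (P Q : seq 'rV[R]_r) (c : 'rV[R]_r).

Definition rowdet (s : seq 'rV[R]_r) : R := \det (\matrix_(i < r) nth 0 s i).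

Lemma rowdet_swap P a c Q : (size P + size Q).+2 = r ->
  rowdet (P ++ a :: c :: Q) = - rowdet (P ++ c :: a :: Q).
Proof.
move=> sz.
have l1 : (size P < r)%N by lia.
have l2 : ((size P).+1 < r)%N by lia.
set i1 := Ordinal l1; set i2 := Ordinal l2.
have -> : rowdet (P ++ a :: c :: Q) =
    \det (xrow i1 i2 (\matrix_(i < r) nth 0 (P ++ c :: a :: Q) i)).
  congr (\det _); apply/matrixP => i j; rewrite !mxE !nth_cat.
  case: tpermP => [->|->|/eqP n1 /eqP n2].
  - by rewrite /= ltnn subnn ltnNge leqnSn /= subSn// subnn.
  - by rewrite /= ltnn subnn ltnNge leqnSn /= subSn// subnn.
  - case: ltnP => // le; case e : (i - size P)%N => [|[|p]] //=.
    + by case/negP: n1; apply/eqP/ord_inj => /=; rewrite -(subnK le) e.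
    + by case/negP: n2; apply/eqP/ord_inj => /=; rewrite -(subnK le) e.
rewrite xrowE det_mulmx det_perm odd_tperm.
have -> : i1 != i2 by apply/eqP => /(congr1 val) /=; lia.
by rewrite expr1 mulN1r.
Qed.

Lemma rowdet_move P c Q : (size P + size Q).+1 = r ->
  rowdet (P ++ c :: Q) = (-1) ^+ size P * rowdet (c :: P ++ Q).
Proof.
elim/last_ind: P Q => [|P a IH] Q; first by rewrite expr0 mul1r.
rewrite size_rcons !cat_rcons => sz.
by rewrite rowdet_swap ?IH /= ?exprS ?mulN1r ?mulNr//; lia.
Qed.

Lemma rowdet_dup P c Q : (size P + size Q).+2 = r -> rowdet (c :: P ++ c :: Q) = 0.
Proof.
move=> sz; have l1 : (0 < r)%N by lia.
have l2 : ((size P).+1 < r)%N by lia.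
apply: (@determinant_alternate _ _ _ (Ordinal l1) (Ordinal l2)) => //.
by move=> j; rewrite !mxE /= nth_cat ltnn subnn.
Qed.

Lemma rowdet_dependent (T : Type) (L : seq T) (h : T -> R) (f : T -> 'rV[R]_r) Q :
  (0 < r)%N -> \sum_(i <- L) h i *: f i = 0 ->
  \sum_(i <- L) h i * rowdet (f i :: Q) = 0.
Proof.
move=> r0 dep; pose z := Ordinal r0.
(* The zero row is a placeholder: cofactors of row 0 do not see that row, so the determinant is
   linear in it with fixed coefficients. *)
pose cof j := cofactor (\matrix_(i < r) nth 0 (0 :: Q) i) z j.
have rE c : rowdet (c :: Q) = \sum_j c 0 j * cof j.
  rewrite /rowdet (expand_det_row _ z); apply: eq_bigr => j _.
  rewrite !mxE /=; congr (_ * _); rewrite /cof /cofactor; congr (_ * \det _).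
  by apply/matrixP => p q; rewrite !mxE /= .
under eq_bigr do rewrite rE mulr_sumr.
rewrite exchange_big /= big1// => j _.
under eq_bigr do rewrite mulrA.
rewrite -mulr_suml; move/rowP/(_ j): dep; rewrite summxE !mxE.
by under eq_bigr do rewrite mxE; move=> ->; rewrite mul0r.
Qed.

Lemma extension_sum_rowdet (T : Type) (f : T -> 'rV[R]_r) (h : T -> R) L K (P : seq T) :
  size K = size L -> (size P + count id K).+1 = r ->
  extension_sum (map h L) K (fun m => rowdet (map f (P ++ mask m L))) =
  (-1) ^+ size P * \sum_(i <- L) h i * rowdet (f i :: map f (P ++ mask K L)).
Proof.
elim: L K P => [|c L IH] [|b K] P //=; first by rewrite big_nil mulr0.
move=> [sz]; rewrite big_cons; case: b => /= szr.
  have := IH K (rcons P c) sz; rewrite size_rcons.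
  have -> : extension_sum [seq h i | i <- L] K
      (fun m => rowdet [seq f i | i <- rcons P c ++ mask m L]) =
    extension_sum [seq h i | i <- L] K
      (fun m => rowdet [seq f i | i <- P ++ c :: mask m L]).
    by congr extension_sum; apply/funext => m; rewrite cat_rcons.
  move=> ->; last by rewrite -szr; lia.
  rewrite cat_rcons map_cat /= rowdet_dup ?mulr0 ?add0r; last first.
    by rewrite !size_map size_mask// -szr; lia.
  by rewrite exprS mulN1r mulNr opprK.
rewrite IH// map_cat /= rowdet_move ?size_map ?size_mask//.
by rewrite map_cat mulrDr mulrCA.
Qed.

Lemma deletion_sum_rowdet (T : Type) (x0 : T) (F : seq T -> R) (h : T -> R) L J (P : seq T) :
  size J = size L ->
  deletion_sum (map h L) J (fun m => F (P ++ mask m L)) =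
  \sum_(j < size (mask J L)) (-1) ^+ j * h (nth x0 (mask J L) j) *
     F (P ++ take j (mask J L) ++ drop j.+1 (mask J L)).
Proof.
elim: L J P => [|c L IH] [|b J] P //=; first by rewrite big_ord0.
move=> [sz]; case: b => /=; last exact: IH.
rewrite big_ord_recl /= drop0 expr0 mul1r; congr (_ + _).
have := IH J (rcons P c) sz.
have -> : (fun m => F (rcons P c ++ mask m L)) = (fun m => F (P ++ c :: mask m L)).
  by apply/funext => m; rewrite cat_rcons.
move=> ->; rewrite -sumrN; apply: eq_bigr => j _.
by rewrite /bump /= add1n add0n /= exprS mulN1r !mulNr cat_rcons.
Qed.

Lemma rowdet_cramer (Q : seq 'rV[R]_r) (u : 'cV[R]_r) : size Q = r.+1 ->
  \sum_(j < r.+1) (-1) ^+ j * (nth 0 Q j *m u) 0 0 *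
     rowdet (take j Q ++ drop j.+1 Q) = 0.
Proof.
move=> sQ.
(* Column 0 is Q u and the others are those of Q, so (1, - u) is a kernel vector; expansion along
   column 0 gives the identity. *)
pose M : 'M[R]_(r.+1) := \matrix_(i, j)
  oapp (fun q => nth 0 Q i 0 q) ((nth 0 Q i *m u) 0 0) (unlift 0 j).
have detM : \det M = 0.
  apply/eqP; rewrite -det_tr; apply/det0P.
  exists (\row_j oapp (fun q => - u q 0) 1 (unlift 0 j)).
    apply/eqP => /rowP/(_ 0); rewrite !mxE unlift_none => /eqP.
    by rewrite oner_eq0.
  apply/rowP => i; rewrite [LHS]mxE [RHS]mxE big_ord_recl !mxE !unlift_none /= mul1r ?mxE.
  apply/eqP; rewrite addr_eq0 -sumrN; apply/eqP; apply: eq_bigr => j _.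
  by rewrite !mxE liftK /= mulNr opprK mulrC.
rewrite -[RHS]detM (expand_det_col _ 0); apply: eq_bigr => j _.
rewrite /cofactor addn0 [M j 0]mxE unlift_none /= mulrCA mulrA; congr (_ * _).
congr (\det _); apply/matrixP => p q; rewrite !mxE liftK /=.
rewrite nth_cat size_take_min sQ.
have -> : minn j r.+1 = j by apply/minn_idPl; rewrite ltnW.
rewrite /= /bump; case: (leqP j p) => jp; first by rewrite nth_drop add1n addSn subnKC.
by rewrite nth_take.
Qed.

End RowDeterminant.

Section Minors.
Variables (R : realType) (n : nat).

Lemma mem_rowspan k (A : 'M[R]_(k, n)) (v : 'rV[R]_n) :
  (v \in rowspan A) = (v <= A)%MS.
Proof.
apply/idP/idP => [|/submxP[u ->]].
  rewrite -[X in _ \in <<X>>%VS]in_tupleE => /coord_span ->.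
  apply: summx_sub => i _; apply: scalemx_sub.
  have /mapP[j _ ->] : (in_tuple [seq row i A | i <- enum 'I_k])`_i \in
      [seq row i A | i <- enum 'I_k] by apply: mem_nth; rewrite ltn_ord.
  exact: row_sub.
rewrite mulmx_sum_row; apply: memv_suml => i _; apply: memvZ.
by apply: memv_span; apply: map_f; rewrite mem_enum.
Qed.

Lemma rowspan_eqmx k l (A : 'M[R]_(k, n)) (B : 'M[R]_(l, n)) :
  rowspan A = rowspan B <-> (A == B)%MS.
Proof.
split=> [e|/eqmxP e]; last first.
  by apply/vspaceP => v; rewrite !mem_rowspan e.
apply/andP; split; apply/row_subP => i.
  by rewrite -mem_rowspan -e mem_rowspan row_sub.
by rewrite -mem_rowspan e mem_rowspan row_sub.
Qed.

Lemma rowspan_subset_eq k (A B : 'M[R]_(k, n)) : row_free A -> row_free B ->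
  (forall v, v \in rowspan A -> v \in rowspan B) -> rowspan A = rowspan B.
Proof.
move=> /eqP fA /eqP fB AB; apply/rowspan_eqmx.
rewrite -mxrank_leqif_eq ?fA ?fB//; apply/row_subP => i.
by rewrite -mem_rowspan AB// mem_rowspan row_sub.
Qed.

Lemma mem_orthov_rowspan k (A : 'M[R]_(k, n)) (w : 'rV[R]_n) :
  w \in Defs.orthov (rowspan A) <-> w *m A^T = 0.
Proof.
split=> [/mem_orthov wA|wA].
  apply/rowP => i; rewrite !mxE -[RHS](wA (row i A)) ?mem_rowspan ?row_sub//.
  by apply: eq_bigr => j _; rewrite !mxE.
apply/mem_orthov => v; rewrite mem_rowspan => /submxP[u ->].
have : (w *m (u *m A)^T) 0 0 = 0 by rewrite trmx_mul mulmxA wA mul0mx mxE.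
by rewrite mxE => e; rewrite -[RHS]e; apply: eq_bigr => i _; rewrite [in RHS]mxE.
Qed.

Lemma orthov_orthov k (A : 'M[R]_(k, n)) (v : 'rV[R]_n) :
  (forall w, w \in Defs.orthov (rowspan A) -> \sum_i w 0 i * v 0 i = 0) ->
  v \in rowspan A.
Proof.
move=> h; rewrite mem_rowspan submxE; apply/eqP/rowP => j; rewrite !mxE.
have := h (row j (cokermx A)^T); rewrite mem_orthov_rowspan => h'.
rewrite -[RHS]h'.
  by apply: eq_bigr => i _; rewrite !mxE mulrC.
by rewrite -row_mul -trmx_mul mulmx_coker trmx0 linear0.
Qed.

(** A form of [plucker] without the cardinality proof in its arguments, so that the set can be
    rewritten freely; it is a Plücker coordinate when #|I| = k. *)
Definition minor k (A : 'M[R]_(k, n)) (I : {set 'I_n}) : R :=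
  rowdet [seq row i A^T | i <- enum I].

Lemma pluckerE k (A : 'M[R]_(k, n)) (I : {set 'I_n}) (cardI : #|I| = k) :
  plucker A cardI = minor A I.
Proof.
rewrite /plucker -det_tr; congr (\det _); apply/matrixP => p q; rewrite !mxE.
have i0 : 'I_n by case: (enum_val (cast_ord (esym cardI) p)) => i; exists i.
rewrite (nth_map i0) ?mxE; last by rewrite -cardE cardI.
by rewrite (enum_val_nth i0).
Qed.

Lemma enum_mask (m : seq bool) : size m = n ->
  mask m (enum 'I_n) = enum [set i : 'I_n | nth false m i]%SET.
Proof.
move=> sm; rewrite [RHS]/enum_mem -enumT filter_mask; congr mask.
have sn : size (Finite.enum 'I_n) = n by rewrite -enumT size_enum_ord.
apply: (@eq_from_nth _ false); rewrite ?size_map ?sn// sm => i lin.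
by rewrite (nth_map (Ordinal lin)) ?size_enum_ord//= inE nth_enum_ord.
Qed.

Lemma minor_mask k (A : 'M[R]_(k, n)) (m : seq bool) : size m = n ->
  rowdet [seq row i A^T | i <- mask m (enum 'I_n)] =
  minor A [set i : 'I_n | nth false m i]%SET.
Proof. by move=> sm; rewrite enum_mask. Qed.

Lemma card_mask (m : seq bool) : size m = n ->
  #|[set i : 'I_n | nth false m i]%SET| = count id m.
Proof. by move=> sm; rewrite cardE -enum_mask// size_mask// size_enum_ord. Qed.

Lemma mask_set (I : {set 'I_n}) : exists2 m : seq bool,
  size m = n & [set i : 'I_n | nth false m i]%SET = I.
Proof.
exists [seq i \in I | i <- enum 'I_n]; first by rewrite size_map size_enum_ord.
by apply/setP => i; rewrite inE (nth_map i) ?size_enum_ord// nth_ord_enum.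
Qed.

(** Nonvanishing ignores the sign of a permutation, so permuting a kernel vector suffices. This
    sorts the columns that [fullrankfun] selects in [row_free_minor]. *)
Lemma rowdet_perm k (s t : seq 'rV[R]_k) : size s = k -> perm_eq s t ->
  rowdet s != 0 -> rowdet t != 0.
Proof.
move=> ss st; have tt : size t = k by rewrite -(perm_size st).
have /(perm_iotaP 0)[u] := st; rewrite perm_sym in st; rewrite tt => pu sE.
pose M (x : seq 'rV[R]_k) := \matrix_(i < k) nth 0 x i.
apply: contraNneq => dt; apply/det0P.
have /det0P[v v0 vM] : \det (M t) == 0 by apply/eqP.
have su : size u = k by rewrite (perm_size pu) size_iota.
have ltu (i : 'I_k) : (nth 0%N u i < k)%N.
  have : nth 0%N u i \in u by rewrite mem_nth// su.
  by rewrite (perm_mem pu) mem_iota add0n.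
pose f i := Ordinal (ltu i).
have injf : injective f.
  move=> i j /(congr1 val) /= /eqP; rewrite nth_uniq ?su//; last first.
    by rewrite (perm_uniq pu) iota_uniq.
  by move/eqP/ord_inj.
exists (\row_i v 0 (f i)).
  apply: contraNneq v0 => e; apply/eqP/rowP => i; rewrite mxE.
  have [g _ gK] := injF_bij injf.
  by move/rowP/(_ (g i)): e; rewrite !mxE gK.
rewrite -[RHS]vM; apply/rowP => j; rewrite !mxE [RHS](reindex_inj injf) /=.
apply: eq_bigr => i _; rewrite !mxE; congr (_ * _).
by rewrite sE (nth_map 0%N) ?su.
Qed.

Lemma row_free_minor k (A : 'M[R]_(k, n)) : row_free A ->
  exists2 I : {set 'I_n}, #|I| = k & minor A I != 0.
Proof.
move=> fA; have fA' : row_full A^T by rewrite /row_full mxrank_tr.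
pose f (i : 'I_k) : 'I_n := fullrankfun fA' i.
have injf : injective f by move=> i j /fullrankfun_inj.
exists [set i in codom f]%SET.
  rewrite -[RHS]card_ord -(card_codom injf).
  by apply: eq_card => i; rewrite inE.
apply: (@rowdet_perm k [seq row i A^T | i <- codom f]).
- by rewrite size_map size_codom card_ord.
- apply: perm_map; apply: uniq_perm; rewrite ?enum_uniq//.
    by rewrite codomE map_inj_uniq ?enum_uniq.
  by move=> i; rewrite mem_enum inE.
have : rowsub f A^T \in unitmx by rewrite -row_full_unit fullrowsub_full.
rewrite unitmxE unitfE; congr (\det _ != 0).
apply/matrixP => p q; rewrite !mxE.
by rewrite codomE -map_comp (nth_map p) ?size_enum_ord// nth_ord_enum !mxE.
Qed.

Lemma signv_signs (w : 'rV[R]_n) : codom (signv w) = signs [seq w 0 i | i <- enum 'I_n].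
Proof. by rewrite codomE /signs -map_comp; apply: eq_map => i; rewrite ffunE. Qed.

Lemma has_neq0 (w : 'rV[R]_n) : w != 0 -> has (predC1 0) [seq w 0 i | i <- enum 'I_n].
Proof.
apply: contraNT => /hasPn h; apply/eqP/rowP => i; rewrite mxE; apply/eqP.
by have := h (w 0 i); rewrite /= negbK; apply; apply: map_f; rewrite mem_enum.
Qed.

Lemma orth_sum_col k (A : 'M[R]_(k, n)) (w : 'rV[R]_n) : w *m A^T = 0 ->
  \sum_(i <- enum 'I_n) w 0 i *: row i A^T = 0.
Proof. by move=> wA; rewrite big_enum /= -mulmx_sum_row. Qed.

Lemma nonneg_orth_altmax k (A : 'M[R]_(k, n)) (w : 'rV[R]_n) : row_free A ->
  (forall I : {set 'I_n}, #|I| = k -> 0 <= minor A I) ->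
  w *m A^T = 0 -> w != 0 -> (k < altmax (codom (signv w)))%N.
Proof.
move=> fA A0 wA w0; rewrite signv_signs.
have sn : size [seq w 0 i | i <- enum 'I_n] = n by rewrite size_map size_enum_ord.
pose D m := rowdet [seq row i A^T | i <- mask m (enum 'I_n)].
apply: (@extension_sum_altmax _ _ _ D); rewrite ?sn.
- by move=> I sI cI; rewrite /D (minor_mask _ sI); apply: A0; rewrite card_mask.
- have [I cI dI] := row_free_minor fA; have [m sm mI] := mask_set I.
  by exists m; split=> //; rewrite ?/D ?minor_mask ?mI// -card_mask// mI.
- move=> K sK cK.
  have := @extension_sum_rowdet R k _ (fun i => row i A^T) (fun i => w 0 i) (enum 'I_n) K [::].
  rewrite size_enum_ord /= => -> //.
  by rewrite rowdet_dependent ?mulr0 ?orth_sum_col//; lia.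
- exact: has_neq0.
Qed.

Lemma pos_altmax k (A : 'M[R]_(k, n)) (w : 'rV[R]_n) :
  (forall I : {set 'I_n}, #|I| = k -> 0 < minor A I) ->
  (w <= A)%MS -> w != 0 -> (altmax (codom (signv w)) <= k)%N.
Proof.
move=> A0 /submxP[u wE] w0; rewrite signv_signs.
have sn : size [seq w 0 i | i <- enum 'I_n] = n by rewrite size_map size_enum_ord.
pose D m := rowdet [seq row i A^T | i <- mask m (enum 'I_n)].
apply: (@deletion_sum_altmax _ _ _ D); rewrite ?sn.
- by move=> I sI cI; rewrite /D (minor_mask _ sI); apply: A0; rewrite card_mask.
- move=> J sJ cJ; set L := enum 'I_n.
  have [i0 _] : exists i0 : 'I_n, true.
    by apply: contrapT => no; case/negP: w0; apply/eqP/rowP => i; case: no; exists i.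
  have sQ : size (mask J L) = k.+1 by rewrite size_mask ?size_enum_ord.
  have := @deletion_sum_rowdet R 'I_n i0 (fun s => rowdet [seq row i A^T | i <- s])
    (fun i => w 0 i) L J [::].
  rewrite size_enum_ord /= => -> //; rewrite sQ.
  rewrite -[RHS](@rowdet_cramer R k [seq row i A^T | i <- mask J L] u^T) ?size_map//.
  apply: eq_bigr => j _; rewrite map_cat map_take map_drop; congr (_ * _ * _).
  rewrite (nth_map i0) ?sQ// wE !mxE.
  by apply: eq_bigr => p _; rewrite !mxE mulrC.
- exact: has_neq0.
Qed.

(* Cramer: the minors A_(K u {i}), with the signs below, are the coordinates of
   a vector of the row space of A that vanishes on K. *)
Lemma minor_orth k (A : 'M[R]_(k, n)) (w : 'rV[R]_n) (K : {set 'I_n}) :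
  w *m A^T = 0 -> #|K|.+1 = k ->
  \sum_(i | i \notin K) (-1) ^+ #|[set x in K | (x < i)%N]%SET| * w 0 i *
     minor A (i |: K)%SET = 0.
Proof.
move=> wA cK.
have ins i : i \notin K -> minor A (i |: K)%SET = (-1) ^+ #|[set x in K | (x < i)%N]%SET| *
    rowdet (row i A^T :: [seq row i A^T | i <- enum K]).
  move=> iK.
  have srt : pairwise (fun x y : 'I_n => (x < y)%N) (enum 'I_n).
    rewrite -sorted_pairwise; last by move=> x y z; exact: ltn_trans.
    by have := iota_ltn_sorted 0 n; rewrite -val_enum_ord sorted_map.
  have [p1 [p2 E]] : exists p1 p2, enum 'I_n = p1 ++ i :: p2.
    have : i \in enum 'I_n by rewrite mem_enum.
    by case/splitPr => p1 p2; exists p1, p2.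
  move: srt; rewrite E pairwise_cat /= allrel_consr.
  move=> /andP[/andP[/allP lt1 _] /andP[_ /andP[/allP lt2 _]]].
  have enumE (S : {set 'I_n}) : enum S = [seq x <- p1 | x \in S] ++
      (if i \in S then [:: i] else [::]) ++ [seq x <- p2 | x \in S].
    by rewrite {1}/enum_mem -enumT E filter_cat /=; case: (i \in S).
  have eq1 : [seq x <- p1 | x \in (i |: K)%SET] = [seq x <- p1 | x \in K].
    apply: eq_in_filter => x /lt1 /= xi.
    by rewrite !inE; case: eqVneq => // e; rewrite e ltnn in xi.
  have eq2 : [seq x <- p2 | x \in (i |: K)%SET] = [seq x <- p2 | x \in K].
    apply: eq_in_filter => x /lt2 /= xi.
    by rewrite !inE; case: eqVneq => // e; rewrite e ltnn in xi.
  have szp : size [seq x <- p1 | x \in K] = #|[set x in K | (x < i)%N]%SET|.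
    rewrite cardE enumE inE ltnn andbF /= size_cat !size_filter.
    rewrite [X in (_ + X)%N](eq_in_count (a2 := pred0)) ?count_pred0 ?addn0.
      by apply: eq_in_count => x /lt1 /= xi; rewrite inE xi andbT.
    by move=> x /lt2 /= xi; rewrite inE [(x < i)%N]ltnNge (ltnW xi) andbF.
  rewrite /minor !enumE eq1 eq2 setU11 (negPf iK) /= map_cat /= rowdet_move.
    by rewrite size_map szp map_cat.
  by rewrite !size_map -cK cardE enumE (negPf iK) size_cat.
transitivity (\sum_(i <- enum 'I_n) w 0 i *
    rowdet (row i A^T :: [seq row i A^T | i <- enum K])); last first.
  by apply: rowdet_dependent; [lia|exact: orth_sum_col].
rewrite big_enum /= [RHS](bigID (mem K)) /= [X in _ = X + _]big1 ?add0r.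
  apply: eq_bigr => i iK; rewrite ins// mulrACA -expr2 sqrr_sign mul1r.
  done.
move=> i iK; move: cK; rewrite cardE; have : i \in enum K by rewrite mem_enum.
case/splitPr => p1 p2; rewrite size_cat /= => sz.
by rewrite map_cat /= rowdet_dup ?mulr0// !size_map -sz; lia.
Qed.
End Minors.

(** * The lines V^perp :&: W *)

Lemma small_scale (R : realType) (T : finType) (f g : T -> R) :
  (forall j, 0 < f j) -> exists2 d : R, 0 < d & forall j, `|d * g j| < f j.
Proof.
move=> f0; pose s := \sum_j `|g j| / f j.
have s0 : 0 <= s by apply: sumr_ge0 => j _; rewrite divr_ge0// ltW.
have s1 : 0 < 1 + s by rewrite ltr_pwDl.
exists (1 + s)^-1; first by rewrite invr_gt0.
move=> j; rewrite normrM gtr0_norm ?invr_gt0// mulrC ltr_pdivrMr// mulrC.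
rewrite -ltr_pdivrMr//; apply: (@le_lt_trans _ _ s); last by rewrite ltrDr.
rewrite /s (bigD1 j)//= lerDl; apply: sumr_ge0 => i _.
by rewrite divr_ge0// ltW.
Qed.

Lemma sign_of_perturb (R : realType) (x y : R) : `|y| < `|x| -> sign_of (x + y) = sign_of x.
Proof.
have [xp|xn|->] := ltrgt0P x; last by rewrite ltNge normr_ge0.
  move=> h; have := ler_norm (- y); rewrite normrN => h'.
  by rewrite (sign_of_gt0 xp) sign_of_gt0//; lra.
move=> h; have := ler_norm y => h'.
by rewrite (sign_of_lt0 xn) sign_of_lt0//; lra.
Qed.

Lemma sign_ofN (R : realType) (x : R) : sign_of (- x) = opp_sign (sign_of x).
Proof.
have [xp|xn|->] := ltrgt0P x.
- by rewrite (sign_of_gt0 xp) sign_of_lt0// oppr_lt0.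
- by rewrite (sign_of_lt0 xn) sign_of_gt0// oppr_gt0.
- by rewrite oppr0 sign_of0.
Qed.

Lemma sign_ofZ (R : realType) (d x : R) : 0 < d -> sign_of (d * x) = sign_of x.
Proof.
move=> d0; have [xp|xn|->] := ltrgt0P x.
- by rewrite (sign_of_gt0 xp) sign_of_gt0// mulr_gt0.
- by rewrite (sign_of_lt0 xn) sign_of_lt0// pmulr_rlt0.
- by rewrite mulr0 sign_of0.
Qed.

Section Line.
Variables (R : realType) (n k : nat) (W : {vspace 'rV[R]_n}).
Hypotheses (kn : (k < n)%N) (Wpos : Gr_pos k.+1 W).
Implicit Types (V : {vspace 'rV[R]_n}) (w : 'rV[R]_n).

Lemma signv_eq0 w i : (signv w i == Sg0) = (w 0 i == 0).
Proof. by rewrite ffunE sign_of_eq0. Qed.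

Lemma signv_neq0 w : w != 0 -> signv w != [ffun=> Sg0].
Proof.
apply: contraNneq => e; apply/eqP/rowP => i; apply/eqP; rewrite mxE -signv_eq0.
by rewrite e ffunE.
Qed.

Lemma phi_altmax V w : Gr_nonneg k V -> w \in phi W V -> w != 0 ->
  altmax (codom (signv w)) = k.+1.
Proof.
move=> [A [fA <-] A0]; rewrite memv_cap => /andP[/mem_orthov_rowspan wA wW] w0.
apply/eqP; rewrite eqn_leq; apply/andP; split.
  case: Wpos => B [fB BW] B0; apply: (@pos_altmax _ _ _ B) => //.
    by move=> I cI; rewrite -(pluckerE B cI) B0.
  by rewrite -mem_rowspan BW.
apply: (@nonneg_orth_altmax _ _ _ A) => // I cI.
by rewrite -(pluckerE A cI) A0.
Qed.

Lemma phi_runs V w : Gr_nonneg k V -> w \in phi W V -> w != 0 ->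
  exists rho b, runs (n - k) rho b (signv w).
Proof.
by move=> V0 wV w0; apply: altmax_runs; [exact: signv_neq0|exact: phi_altmax wV w0].
Qed.

(* If y and x are independent in V^perp :&: W, with x_a != 0 and y zero up to
   a, then one of y +- d x has one more run than y, the extra one at a. *)
Lemma phi_no_pivot V x y a : Gr_nonneg k V -> x \in phi W V -> y \in phi W V ->
  y != 0 -> x 0 a != 0 -> (forall i : 'I_n, (i <= a)%N -> y 0 i = 0) -> False.
Proof.
move=> V0 xV yV y0 xa ya; have [rho [b ry]] := phi_runs V0 yV y0.
have [r hr homr] := runs_reps ry; have [_ sgn _] := ry.
have yr j : y 0 (r j) != 0 by rewrite -signv_eq0 (hr j).2.
have ar j : (a < r j)%N.
  by rewrite ltnNge; apply/negP => /ya e; have := yr j; rewrite e eqxx.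
have [d d0 dP] := @small_scale R _ (fun j => `|y 0 (r j)|) (fun j => x 0 (r j))
  (fun j => ltac:(by rewrite normr_gt0)).
(* The sign of the perturbation is chosen so that z has at [a] the alternated sign opposite to the
   first run of y, while [d] is too small to change signs at the representatives. *)
pose e := altbit (signv x) a == b.
pose z := y + ((-1) ^+ e * d) *: x.
have zV : z \in phi W V by rewrite memvD// memvZ.
have za : sign_of (z 0 a) = if e then opp_sign (sign_of (x 0 a)) else sign_of (x 0 a).
  rewrite !mxE ya// add0r -mulrA; case: (e); rewrite /= ?expr1 ?expr0.
    by rewrite mulN1r sign_ofN sign_ofZ.
  by rewrite mul1r sign_ofZ.
have za0 : signv z a != Sg0.
  rewrite ffunE za; have := xa; rewrite -sign_of_eq0.
  by case: (e); case: (sign_of (x 0 a)).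
have zr j : signv z (r j) = signv y (r j).
  rewrite !ffunE !mxE sign_of_perturb// -mulrA normrM normr_sign mul1r; exact: dP.
have z0 : z != 0 by apply: contraNneq za0 => ->; rewrite ffunE mxE sign_of0.
have [rho' [b' [lab' sgn' _]]] := phi_runs V0 zV z0.
pose r' (i : 'I_(n - k).+1) := oapp r a (unlift 0 i).
have alt_a : altbit (signv z) a = ~~ b.
  rewrite /altbit ffunE za; move: xa; rewrite -sign_of_eq0 /e /altbit ffunE.
  by case: (sign_of (x 0 a)) => //= _; case: (odd a); case: (b).
have alt_r j : altbit (signv z) (r j) = b (+) odd j.
  by rewrite /altbit zr -[LHS]/(altbit (signv y) (r j)) sgn ?(hr j).2// (hr j).1.
have alt' i : altbit (signv z) (r' i) = ~~ b (+) odd i /\ signv z (r' i) != Sg0.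
  rewrite /r'; case: unliftP => [j ->|->] /=; last by rewrite addbF.
  by rewrite alt_r zr (hr j).2 /bump /= ?add1n /=; case: (b); case: (odd j).
apply: (@no_long_alternating n (n - k) rho' r') => //.
- move=> i j; rewrite /r'.
  case: unliftP => [i' ->|->]; case: unliftP => [j' ->|->] //=.
  by rewrite /bump /= ?add1n ?ltnS => /homr.
- move=> i j ij; apply/eqP => eij.
  have := (alt' j).1; rewrite sgn' ?(alt' j).2// -eij -sgn' ?(alt' i).2// (alt' i).1.
  by rewrite ij /=; case: (b); case: (odd i).
Qed.

Lemma phi_line V w : Gr_nonneg k V -> w \in phi W V -> w != 0 -> phi W V = <[w]>%VS.
Proof.
move=> V0 wV w0; apply/eqP; rewrite eqEsubv -memvE wV andbT.
apply/subvP => p pV; apply: contrapT => /negP pw.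
have nz i0 : w 0 i0 != 0 -> (w 0 i0 != 0) || (p 0 i0 != 0) by move=> ->.
have [i0 wi0] : exists i0, w 0 i0 != 0.
  apply: contrapT => no; case/negP: w0; apply/eqP/rowP => i; rewrite mxE.
  by apply/eqP/negPn/negP => wi; apply: no; exists i.
(* At the first index where w or p is nonzero one of them can be eliminated, which leaves a nonzero
   vector vanishing up to that index. *)
case: (arg_minnP (P := fun i => (w 0 i != 0) || (p 0 i != 0)) (@nat_of_ord n) (nz _ wi0)).
move=> a wpa mina.
have zero (i : 'I_n) : (i < a)%N -> w 0 i = 0 /\ p 0 i = 0.
  move=> ia; have : ~~ ((w 0 i != 0) || (p 0 i != 0)).
    by apply/negP => /mina; rewrite leqNgt ia.
  by rewrite negb_or !negbK => /andP[/eqP-> /eqP->].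
have [wa|wa] := eqVneq (w 0 a) 0.
  have pa : p 0 a != 0 by move: wpa; rewrite wa eqxx.
  apply: (phi_no_pivot V0 pV wV w0 pa) => i; rewrite leq_eqVlt => /orP[/eqP/val_inj->//|].
  by move=> /zero[].
pose y := p - (p 0 a / w 0 a) *: w.
have yV : y \in phi W V by rewrite memvB// memvZ.
apply: (phi_no_pivot V0 wV yV _ wa).
  apply: contraNneq pw => /eqP; rewrite subr_eq0 => /eqP ->.
  by rewrite memvZ// memv_line.
move=> i; rewrite leq_eqVlt => /orP[/eqP/val_inj->|/zero[wi pi]]; rewrite !mxE.
  by rewrite divfK// subrr.
by rewrite wi pi mulr0 subr0.
Qed.

Lemma phi_neq0 V : Gr_nonneg k V -> exists2 w, w \in phi W V & w != 0.
Proof.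
move=> [A [fA <-] A0]; case: Wpos => B [fB BW] _.
(* The matrix has k + 1 rows and only k columns. *)
have : kermx (B *m A^T) != 0.
  rewrite -mxrank_eq0 mxrank_ker -lt0n subn_gt0 ltnS.
  exact: leq_trans (rank_leq_col _) _.
case/rowV0Pn => c /sub_kermxP cM c0; exists (c *m B).
  rewrite memv_cap; apply/andP; split; last by rewrite -BW mem_rowspan submxMl.
  by apply/mem_orthov_rowspan; rewrite -mulmxA.
by rewrite mulmx_free_eq0.
Qed.

Lemma phi_ex V : Gr_nonneg k V -> exists w, [/\ w != 0, w \in phi W V,
  phi W V = <[w]>%VS & exists rho b, runs (n - k) rho b (signv w)].
Proof.
move=> V0; have [w wV w0] := phi_neq0 V0.
by exists w; split=> //; [exact: phi_line|exact: (phi_runs V0)].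
Qed.
End Line.

(** * Subspaces cut out by disjoint blocks *)

Section KernelMatrix.
Variables (R : realType) (n m k : nat) (r : 'I_m -> 'I_n).
Hypotheses (injr : injective r).
Let C : {set 'I_n} := (~: [set r l | l : 'I_m])%SET.
Hypothesis cardC : #|C| = k.

Definition free_index (p : 'I_k) : 'I_n := enum_val (cast_ord (esym cardC) p).

(* The row indexed by [c = free_index p] is
   e_c - sum_l (y_l(c) / y_l(r_l)) e_(r_l). *)
Definition kermat (y : 'I_m -> 'rV[R]_n) : 'M[R]_(k, n) :=
  \matrix_(p, q) ((q == free_index p)%:R -
    \sum_l y l 0 (free_index p) / y l 0 (r l) * (q == r l)%:R).

Lemma free_index_inj : injective free_index.
Proof. by move=> p q /enum_val_inj /cast_ord_inj. Qed.

Lemma free_index_neq p l : free_index p != r l.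
Proof.
have : free_index p \in C by apply: enum_valP.
by rewrite inE; apply: contraNneq => ->; apply: imset_f.
Qed.

Lemma free_indexP i : (exists p, i = free_index p) \/ (exists l, i = r l).
Proof.
have [iC|] := boolP (i \in C); last first.
  by rewrite inE negbK => /imsetP[l _ ->]; right; exists l.
left; exists (cast_ord cardC (enum_rank_in iC i)).
by rewrite /free_index cast_ordK enum_rankK_in.
Qed.

Lemma sum_free_index (F : 'I_n -> R) :
  \sum_i F i = \sum_p F (free_index p) + \sum_l F (r l).
Proof.
have imE (T : finType) (h : T -> 'I_n) : injective h ->
    \sum_(i in [set h x | x : T]%SET) F i = \sum_x F (h x).
  by move=> injh; rewrite big_imset//= => ? ? _ _ /injh.
rewrite -(imE _ _ free_index_inj) -(imE _ _ injr) (bigID (mem C)) /=.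
congr (_ + _); apply: eq_bigl => i; last by rewrite inE negbK.
apply/idP/imsetP => [iC|[p _ ->]]; last exact: enum_valP.
have [[p ->]|[l e]] := free_indexP i; first by exists p.
by move: iC; rewrite e inE imset_f.
Qed.

Variable y : 'I_m -> 'rV[R]_n.
Hypotheses (yr0 : forall j l, l != j -> y j 0 (r l) = 0) (yr : forall j, y j 0 (r j) != 0).

Lemma kermat_free p q : kermat y p (free_index q) = (p == q)%:R.
Proof.
rewrite mxE big1 ?subr0 => [|l _]; last by rewrite (negPf (free_index_neq _ _)) mulr0.
by rewrite (inj_eq free_index_inj) eq_sym.
Qed.

Lemma kermat_rep p l : kermat y p (r l) = - (y l 0 (free_index p) / y l 0 (r l)).
Proof.
rewrite mxE eq_sym (negPf (free_index_neq _ _)) sub0r (bigD1 l)//= eqxx mulr1.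
rewrite big1 ?addr0// => j jl.
by rewrite (inj_eq injr) eq_sym (negPf jl) mulr0.
Qed.

Lemma kermat_row_free : row_free (kermat y).
Proof.
apply/row_freeP; exists (\matrix_(i, q) (i == free_index q)%:R).
apply/matrixP => p q; rewrite !mxE (bigD1 (free_index q))//= big1.
  by rewrite addr0 kermat_free !mxE eqxx mulr1.
by move=> i /negPf iq; rewrite !mxE iq mulr0.
Qed.

(** The coordinates at the free indices are arbitrary, and the j-th equation involves only one other
    coordinate, the one at r_j, for which it can be solved since y_j does not vanish there. *)
Lemma mem_kermat v :
  v \in rowspan (kermat y) <-> forall j, \sum_i y j 0 i * v 0 i = 0.
Proof.
rewrite mem_rowspan; split=> [/submxP[u ->] j|vy].
  rewrite sum_free_index (bigD1 j)//= [X in _ + (_ + X)]big1 ?addr0; last first.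
    by move=> l lj; rewrite yr0// mul0r.
  have uc p : (u *m kermat y) 0 (free_index p) = u 0 p.
    rewrite mxE (bigD1 p)//= kermat_free eqxx mulr1 big1 ?addr0// => q qp.
    by rewrite kermat_free (negPf qp) mulr0.
  under eq_bigr do rewrite uc.
  rewrite mxE mulr_sumr -big_split /= big1// => p _; rewrite kermat_rep.
  by have := yr j => yj; field.
apply/submxP; exists (\row_p v 0 (free_index p)); apply/rowP => i; rewrite mxE.
have [[q ->]|[l ->]] := free_indexP i.
  rewrite (bigD1 q)//= mxE kermat_free eqxx mulr1 big1 ?addr0// => p pq.
  by rewrite kermat_free (negPf pq) mulr0.
have := vy l; rewrite sum_free_index (bigD1 l)//= [X in _ + (_ + X)]big1 ?addr0.
  move=> /eqP; rewrite addrC addr_eq0 => /eqP e; have yl := yr l.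
  apply: (mulfI yl); rewrite e mulr_sumr -sumrN; apply: eq_bigr => p _.
  by rewrite mxE kermat_rep; field.
by move=> j jl; rewrite yr0 ?mul0r// eq_sym.
Qed.

(** The free columns form an identity matrix. This normalisation is what fixes the signs of the
    other minors in [runs_blocks_orth]. *)
Lemma minor_kermat : minor (kermat y) C = 1.
Proof.
rewrite -(pluckerE _ cardC) /plucker -[RHS](det1 _ k); congr (\det _).
by apply/matrixP => p q; rewrite mxE [RHS]mxE kermat_free.
Qed.
End KernelMatrix.

(** * Two-term relations between minors *)

Section TwoTerm.
Variables (R : realType) (n : nat).

Lemma card_below (K : {set 'I_n}) (a b : 'I_n) : (a < b)%N -> a \notin K ->
  (forall x : 'I_n, (a < x < b)%N -> x \in K) ->
  #|[set x in K | (x < b)%N]%SET| = (#|[set x in K | (x < a)%N]%SET| + (b - a.+1))%N.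
Proof.
move=> ab aK btw.
have -> : [set x in K | (x < b)%N]%SET =
    ([set x in K | (x < a)%N] :|: [set x : 'I_n | (a < x < b)%N])%SET.
  apply/setP => x; rewrite !inE; case: (ltngtP x a) => xa /=.
  - by rewrite (ltn_trans xa ab) orbF.
  - rewrite andbF /=; apply/andP/idP => [[]//|xb].
    by split=> //; apply: btw; rewrite xa.
  - by rewrite andbF (val_inj xa) (negPf aK).
rewrite cardsU [X in (_ - X)%N](_ : _ = 0%N) ?subn0; last first.
  apply/eqP; rewrite cards_eq0; apply/eqP/setP => x; rewrite !inE.
  by case: (ltngtP x a); rewrite ?andbF.
congr addn; rewrite cardsE cardE size_filter -enumT.
have -> : count (fun x : 'I_n => (a < x < b)%N) (enum 'I_n) =
    count (fun x => (a < x < b)%N) (iota 0 n).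
  by rewrite -val_enum_ord count_map.
have -> : iota 0 n = iota 0 a.+1 ++ iota a.+1 (b - a.+1) ++ iota b (n - b).
  have e : (a.+1 + ((b - a.+1) + (n - b)) = n)%N by have := ltn_ord b; lia.
  by rewrite -[in LHS]e iotaD add0n iotaD subnKC.
rewrite !count_cat [X in (X + _)%N](_ : _ = 0%N) ?add0n.
  rewrite [X in (_ + X)%N](_ : _ = 0%N) ?addn0.
    rewrite (eq_in_count (a2 := predT)) ?count_predT ?size_iota// => x.
    by rewrite mem_iota subnKC.
  apply/eqP; rewrite -leqn0 leqNgt -has_count; apply/hasPn => x.
  by rewrite mem_iota; lia.
apply/eqP; rewrite -leqn0 leqNgt -has_count; apply/hasPn => x.
by rewrite mem_iota; lia.
Qed.

(** Only the terms of a and b survive in [minor_orth]. All indices between them lie in K, so their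
    signs differ by (-1)^(b - a - 1), which the factors (-1)^a and (-1)^b absorb; this is where
    alternation enters. *)
Lemma minor_two_term k (A : 'M[R]_(k, n)) (w : 'rV[R]_n) (K : {set 'I_n}) (a b : 'I_n) :
  w *m A^T = 0 -> #|K|.+1 = k -> a != b -> a \notin K -> b \notin K ->
  (forall x : 'I_n, (a < x < b)%N || (b < x < a)%N -> x \in K) ->
  (forall i, i \notin K -> i != a -> i != b -> w 0 i * minor A (i |: K)%SET = 0) ->
  (-1) ^+ a * w 0 a * minor A (a |: K)%SET = (-1) ^+ b * w 0 b * minor A (b |: K)%SET.
Proof.
wlog ab : a b / (a < b)%N.
  move=> H wA cK; rewrite neq_ltn => /orP[ab|ba] aK bK btw oth.
    by apply: H => //; rewrite neq_ltn ab.
  apply/esym; apply: H => //; rewrite ?neq_ltn ?ba//.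
    by move=> x xb; apply: btw; rewrite orbC.
  by move=> i iK ib ia; apply: oth.
move=> wA cK neq aK bK btw oth; have := minor_orth wA cK.
rewrite (bigD1 a)//= (bigD1 b) /=; last by rewrite bK eq_sym.
rewrite big1 ?addr0 => [|i /andP[/andP[iK ia] ib]]; last by rewrite -mulrA oth ?mulr0.
rewrite (card_below ab aK); last by move=> x xab; apply: btw; rewrite xab.
move/eqP; rewrite exprD -!mulrA -mulrDr mulf_eq0 signr_eq0 /=.
have -> : (-1) ^+ (b - a.+1) = - ((-1) ^+ a * (-1) ^+ b) :> R.
  rewrite -exprD -signr_odd -[in RHS]signr_odd oddB// oddD /=.
  by case: (odd a); case: (odd b); rewrite /= ?expr0 ?expr1 ?opprK.
rewrite mulNr subr_eq0 => /eqP ->.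
by rewrite !mulrA -expr2 sqrr_sign mul1r.
Qed.

Lemma altbit_eq (w : 'rV[R]_n) (i j : 'I_n) : w 0 i != 0 -> w 0 j != 0 ->
  (altbit (signv w) i == altbit (signv w) j) =
  (0 < (-1) ^+ i * w 0 i * ((-1) ^+ j * w 0 j)).
Proof.
move=> wi wj.
have H (l : 'I_n) : w 0 l != 0 ->
    (-1) ^+ l * w 0 l = (-1) ^+ (altbit (signv w) l) * `|w 0 l|.
  move=> wl; rewrite /altbit ffunE -(signr_odd _ l).
  have [wp|wn|w0] := ltrgt0P (w 0 l); last by rewrite w0 eqxx in wl.
    by rewrite (sign_of_gt0 wp) /=.
  by rewrite (sign_of_lt0 wn) /=; case: (odd l); rewrite /= ?expr0 ?expr1; ring.
rewrite (H i)// (H j)// mulrACA -signr_addb.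
have wij : 0 < `|w 0 i| * `|w 0 j| by rewrite mulr_gt0 ?normr_gt0.
rewrite (pmulr_lgt0 _ wij) signr_gt0.
by case: (altbit _ i); case: (altbit _ j).
Qed.
End TwoTerm.

(** * Transversals of runs and the subspace attached to a vector *)

Definition ssupp n (s : signvec n) : {set 'I_n} := [set i | s i != Sg0]%SET.

(* The complements of the transversals, inside X, of the fibres of [rho] over
   0, ..., m - 1. *)
Definition run_bases n m (rho : 'I_n -> nat) (X : {set 'I_n}) : {set {set 'I_n}} :=
  [set (~: [set t j | j : 'I_m]) | t : {ffun 'I_m -> 'I_n} &
     [forall j, (rho (t j) == j :> nat) && (t j \in X)]]%SET.

Lemma run_basesP n m (rho : 'I_n -> nat) (X I : {set 'I_n}) :
  I \in run_bases m rho X <-> exists t : 'I_m -> 'I_n,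
    (forall j, rho (t j) = j :> nat /\ t j \in X) /\ I = (~: [set t j | j : 'I_m])%SET.
Proof.
split=> [/imsetP[t] | [t [tP ->]]].
  rewrite inE => /forallP tP ->; exists t; split=> // j.
  by have /andP[/eqP] := tP j.
apply/imsetP; exists (finfun t).
  by rewrite inE; apply/forallP => j; rewrite ffunE (tP j).1 eqxx (tP j).2.
by congr (~: _)%SET; apply: eq_imset => j; rewrite ffunE.
Qed.

Section Transversal.
Variables (n m : nat) (rho : 'I_n -> nat) (t : 'I_m -> 'I_n).
Hypothesis rt : forall j, rho (t j) = j :> nat.

Lemma transversal_inj : injective t.
Proof. by move=> i j e; apply: val_inj; rewrite /= -!rt e. Qed.

Lemma card_transversalC : (m <= n)%N -> #|(~: [set t j | j : 'I_m])%SET| = (n - m)%N.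
Proof.
move=> mn; have := cardsC [set t j | j : 'I_m]%SET.
by rewrite (card_imset _ transversal_inj) !card_ord; lia.
Qed.

Lemma notin_transversalC i : i \notin (~: [set t j | j : 'I_m])%SET ->
  exists2 j, i = t j & rho i = j.
Proof. by rewrite inE negbK => /imsetP[j _ ->]; exists j. Qed.

Lemma in_transversalC i (j : 'I_m) : rho i = j -> i != t j ->
  i \in (~: [set t j | j : 'I_m])%SET.
Proof.
move=> ij it; rewrite inE; apply/negP => /imsetP[l _ e].
by case/negP: it; rewrite e; apply/eqP; congr t; apply: val_inj; rewrite /= -ij e rt.
Qed.
End Transversal.

Lemma label_between n (rho : 'I_n -> nat) (a b x : 'I_n) :
  {homo rho : i j / (i <= j)%N} -> rho a = rho b ->
  (a < x < b)%N || (b < x < a)%N -> rho x = rho a.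
Proof.
move=> homo e /orP[] /andP[/ltnW/homo h1 /ltnW/homo h2]; apply/eqP; rewrite eqn_leq.
  by rewrite e h2 -e h1.
by rewrite h2 e h1.
Qed.

Section BlockSubspace.
Variables (R : realType) (n : nat).
Implicit Types (V : {vspace 'rV[R]_n}) (w : 'rV[R]_n).

(** V is the orthogonal complement of the restrictions of w to the fibres of [rho]. *)
Definition blocks_orth (rho : 'I_n -> nat) w V : Prop :=
  forall v, v \in V <-> forall j, \sum_(i | rho i == j) w 0 i * v 0 i = 0.

Lemma blocks_orth_uniq rho rho' w V V' : (forall i, w 0 i != 0 -> rho i = rho' i) ->
  blocks_orth rho w V -> blocks_orth rho' w V' -> V = V'.
Proof.
move=> e VP VP'; apply/vspaceP => v; apply/idP/idP.
  move=> /VP h; apply/VP' => j; rewrite -[RHS](h j) big_mkcond [RHS]big_mkcond.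
  by apply: eq_bigr => i _; have [->|/e->//] := eqVneq (w 0 i) 0; rewrite mul0r !if_same.
move=> /VP' h; apply/VP => j; rewrite -[RHS](h j) big_mkcond [RHS]big_mkcond.
by apply: eq_bigr => i _; have [->|/e->//] := eqVneq (w 0 i) 0; rewrite mul0r !if_same.
Qed.

Lemma blocks_orth_mem rho w V : blocks_orth rho w V -> w \in Defs.orthov V.
Proof.
move=> VP; apply/mem_orthov => v /VP h.
transitivity (\sum_(j < (\max_i rho i).+1) \sum_(i | rho i == j) w 0 i * v 0 i).
  rewrite (partition_big (fun i => inord (rho i) : 'I_(\max_i rho i).+1) predT)//=.
  apply: eq_bigr => j _; apply: eq_bigl => i.
  by rewrite -val_eqE /= inordK// ltnS leq_bigmax.
by rewrite big1.
Qed.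

Lemma runs_blocks_orth m k rho b w : (k + m)%N = n -> runs m rho b (signv w) ->
  exists2 V, blocks_orth rho w V & positroid_cell k (run_bases m rho (ssupp (signv w))) V.
Proof.
move=> kmn rs; have [r hr homr] := runs_reps rs; have [[homo ltm] sgn _] := rs.
have rr j : rho (r j) = j := (hr j).1.
have wr j : w 0 (r j) != 0 by rewrite -signv_eq0 (hr j).2.
have injr : injective r := transversal_inj rr.
have nm : (n - m)%N = k by lia.
have cardC : #|(~: [set r l | l : 'I_m])%SET| = k by rewrite (card_transversalC rr)//; lia.
pose y (j : 'I_m) : 'rV[R]_n := \row_i (if rho i == j then w 0 i else 0).
have yr0 j l : l != j -> y j 0 (r l) = 0 by move=> lj; rewrite mxE rr val_eqE (negPf lj).
have yr j : y j 0 (r j) != 0 by rewrite mxE rr eqxx.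
pose A := kermat cardC y; have fA : row_free A by apply: kermat_row_free.
have memA v : v \in rowspan A <-> forall j, \sum_i y j 0 i * v 0 i = 0 by apply: mem_kermat.
have yA j : y j *m A^T = 0.
  apply/mem_orthov_rowspan/mem_orthov => v /memA; exact.
have cardI (I : {set 'I_n}) : #|I| = k -> forall i, i \in I -> #|(I :\ i)%SET|.+1 = k.
  by move=> <- i iI; rewrite (cardsD1 i I) iI.
(* A k-set that is not a basis contains the whole support of some run j. For y_j and K = I \ {r_j}
   the relation then has only the term at r_j, so the minor vanishes. *)
have offM (I : {set 'I_n}) : #|I| = k ->
    I \notin run_bases m rho (ssupp (signv w)) -> minor A I = 0.
  move=> cI IM.
  have [j jP] : exists j : 'I_m, forall i, rho i = j -> w 0 i != 0 -> i \in I.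
    apply: contrapT => no; case/negP: IM; apply/run_basesP.
    have /choice[t tP] : forall j : 'I_m, exists i, [/\ rho i = j, w 0 i != 0 & i \notin I].
      move=> j; apply: contrapT => no'; apply: no; exists j => i ij wi.
      by apply: contrapT => /negP iI; apply: no'; exists i.
    have rt j : rho (t j) = j by have [] := tP j.
    exists t; split=> [j|]; first by have [ij wi _] := tP j; rewrite inE signv_eq0.
    apply/eqP; rewrite eqEcard cI (card_transversalC rt) ?nm ?leqnn ?andbT; last by lia.
    apply/fintype.subsetP => i iI; rewrite inE; apply/negP => /imsetP[j _ e].
    by have [_ _] := tP j; rewrite -e iI.
  have rI : r j \in I by apply: jP.
  have := minor_orth (yA j) (cardI _ cI _ rI); rewrite (bigD1 (r j)) ?finset.setD11//= big1.
    rewrite addr0 => /eqP; rewrite finset.setD1K// !mulf_eq0 signr_eq0 (negPf (yr j)) /=.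
    by move/eqP.
  move=> i /andP[]; rewrite !inE => iI ir; rewrite mxE.
  case: eqP => [ij|_]; last by rewrite mulr0 mul0r.
  have [->|wi] := eqVneq (w 0 i) 0; first by rewrite mulr0 mul0r.
  by move: iI; rewrite ir (jP _ ij wi).
(* The transversal is moved to [r], where the minor is 1, one run at a time. Each move compares two
   minors by the two-term relation of y_j, whose coefficients have the same sign because t_j and r_j
   lie in one run. *)
have onM (I : {set 'I_n}) : I \in run_bases m rho (ssupp (signv w)) -> 0 < minor A I.
  move=> /run_basesP[t [tP ->]] {I}.
  have [N] := ubnP #|[set j | t j != r j]%SET|; elim: N t tP => // N IH t tP.
  have rt j : rho (t j) = j := (tP j).1.
  have wt j : w 0 (t j) != 0 by have := (tP j).2; rewrite inE signv_eq0.
  have [/existsP[j tj]|/existsPn tr] := boolP [exists j, t j != r j]; last first.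
    move=> _; have -> : [set t j | j : 'I_m]%SET = [set r j | j : 'I_m]%SET.
      by apply: eq_imset => j; apply/eqP/negPn/tr.
    by rewrite minor_kermat.
  pose t' l := if l == j then r j else t l.
  have t'P l : rho (t' l) = l :> nat /\ t' l \in ssupp (signv w).
    rewrite /t'; case: (eqVneq l j) => [->|_] //.
    by rewrite rr inE signv_eq0.
  have rt' l : rho (t' l) = l := (t'P l).1.
  rewrite ltnS => cN; have {IH} := IH t' t'P _.
  set I := (~: [set t j | j : 'I_m])%SET; set I' := (~: [set t' j | j : 'I_m])%SET.
  have -> : (#|[set j | t' j != r j]%SET| < N)%N.
    apply: leq_trans cN; apply: proper_card; apply/properP; split.
      apply/fintype.subsetP => l; rewrite !inE /t'; case: (eqVneq l j) => [->|//].
      by rewrite eqxx.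
    by exists j; rewrite !inE ?tj// /t' eqxx eqxx.
  move=> /(_ isT) I'0.
  have rI : r j \in I by apply: (in_transversalC rt (rr j)); rewrite eq_sym.
  have tI' : t j \in I'.
    by apply: (in_transversalC rt' (rt j)); rewrite /t' eqxx.
  pose K := (I :\ r j)%SET.
  have IK : (r j |: K)%SET = I by rewrite finset.setD1K.
  have I'K : (t j |: K)%SET = I'.
    apply/setP => x; rewrite !inE.
    have [->|xt] /= := eqVneq x (t j); first by move: tI'; rewrite inE.
    have [->|xr] /= := eqVneq x (r j).
      by apply/esym/negbTE; rewrite negbK; apply/imsetP; exists j; rewrite // /t' eqxx.
    congr (~~ _); apply/imsetP/imsetP => -[l _ e].
      have lj : l != j by apply: contraNneq xt => <-; rewrite e.
      by exists l; rewrite // /t' (negPf lj).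
    move: e; rewrite /t'; case: (eqVneq l j) => [_ e|lj e]; last by exists l.
    by move: xr; rewrite e eqxx.
  have cI : #|I| = k by rewrite (card_transversalC rt)//; lia.
  have := @minor_two_term _ _ _ A (y j) K (t j) (r j) (yA j) (cardI _ cI _ rI) tj.
  rewrite IK I'K => two.
  have {two} : (-1) ^+ t j * y j 0 (t j) * minor A I' = (-1) ^+ r j * y j 0 (r j) * minor A I.
    apply: two.
    - by rewrite !inE negb_and negbK imset_f ?orbT.
    - by rewrite !inE eqxx.
    - move=> x xb; have xj : rho x = j by rewrite (label_between homo _ xb) rt ?rr.
      rewrite finset.in_setD1; apply/andP; split.
        by apply: contraTneq xb => ->; rewrite ltnn andbF.
      apply: (in_transversalC rt xj).
      by apply: contraTneq xb => ->; rewrite ltnn andbF.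
    - move=> i iK it ir; rewrite mxE; case: eqP => [ij|_]; last by rewrite mul0r.
      case/negP: iK; rewrite finset.in_setD1 ir /=.
      exact: (in_transversalC rt ij).
  rewrite !mxE rt rr eqxx => e.
  have : altbit (signv w) (t j) == altbit (signv w) (r j).
    by rewrite !sgn ?signv_eq0// rt rr.
  rewrite altbit_eq// => xx.
  set p := (-1) ^+ t j * w 0 (t j) in xx e; set q := (-1) ^+ r j * w 0 (r j) in xx e.
  have q0 : q != 0 by rewrite mulf_neq0 ?signr_eq0.
  have : 0 < q * (q * minor A I) by rewrite -e mulrA (mulrC q) mulr_gt0.
  by rewrite mulrA pmulr_rgt0// -expr2 exprn_even_gt0.
exists (rowspan A).
  move=> v; rewrite memA; split=> h j.
    have [jm|jm] := ltnP j m.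
      rewrite -[RHS](h (Ordinal jm)) big_mkcond; apply: eq_bigr => i _.
      by rewrite mxE /=; case: ifP => //; rewrite mul0r.
    by rewrite big1// => i /eqP ij; have := ltm i; rewrite ij ltnNge jm.
  rewrite -[RHS](h j) [RHS]big_mkcond; apply: eq_bigr => i _.
  by rewrite mxE; case: ifP => //; rewrite mul0r.
split.
  exists A => // I cI; rewrite pluckerE.
  have [/onM/ltW//|/offM->//] := boolP (I \in run_bases m rho (ssupp (signv w))).
by exists A => // I cI; rewrite !pluckerE; split=> [/onM|/offM->].
Qed.
End BlockSubspace.

(** * Recovering the runs and the subspace from a cell *)

Section CellRuns.
Variables (R : realType) (n k : nat) (W : {vspace 'rV[R]_n}).
Hypotheses (kn : (k < n)%N) (Wpos : Gr_pos k.+1 W).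

(** Relative to a basis I0, two-term relations make the alternation of every z in V^perp
    proportional, on each block, to one nonnegative vector [q]. So the alternation of w has constant
    sign on each block; as w has n - k runs, [runs_uniq] identifies the blocks with the runs. *)
Lemma phi_blocks (A : 'M[R]_(k, n)) rho w : row_free A ->
  (forall I : {set 'I_n}, #|I| = k -> 0 <= minor A I) -> labelling (n - k) rho ->
  (forall I : {set 'I_n}, #|I| = k -> minor A I != 0 -> exists t : 'I_(n - k) -> 'I_n,
     (forall j, rho (t j) = j :> nat) /\ I = (~: [set t j | j : 'I_(n - k)])%SET) ->
  w \in phi W (rowspan A) -> w != 0 ->
  (exists b, runs (n - k) rho b (signv w)) /\ blocks_orth rho w (rowspan A).
Proof.
move=> fA A0 lab bases wV w0; have [homo ltm] := lab.
have [I0 cI0 I0n] := row_free_minor fA; have [r [rr I0E]] := bases _ cI0 I0n.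
have I0p : 0 < minor A I0 by rewrite lt_def I0n A0.
have injr : injective r := transversal_inj rr.
pose lb i : 'I_(n - k) := Ordinal (ltm i).
pose q i := if i == r (lb i) then 1 else
  minor A (r (lb i) |: (I0 :\ i))%SET / minor A I0.
have in0 i : i != r (lb i) -> i \in I0.
  by move=> ir; rewrite I0E; apply: (in_transversalC rr (j := lb i)).
have q0 i : 0 <= q i.
  rewrite /q; case: eqVneq => // ir; apply: divr_ge0; last exact: ltW.
  apply: A0; rewrite cardsU1 finset.in_setD1 (_ : r _ \in I0 = false) ?andbF; last first.
    by rewrite I0E inE imset_f.
  by rewrite -cI0 (cardsD1 i I0) in0.
have orthE (z : 'rV[R]_n) : z *m A^T = 0 -> forall i : 'I_n,
    (-1) ^+ i * z 0 i = (-1) ^+ r (lb i) * z 0 (r (lb i)) * q i.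
  move=> zA i; rewrite /q; case: eqVneq => [<-|ir]; first by rewrite mulr1.
  have iI0 := in0 _ ir.
  have rI0 l : r l \notin I0 by rewrite I0E inE negbK imset_f.
  have := @minor_two_term _ _ _ A z (I0 :\ i)%SET i (r (lb i)) zA _ ir.
  rewrite finset.setD1K// => two; rewrite mulrA -two.
  - by rewrite mulfK.
  - by rewrite -cI0 (cardsD1 i I0) iI0.
  - by rewrite !inE eqxx.
  - by rewrite finset.in_setD1 negb_and rI0 orbT.
  - move=> x xb; have xi : rho x = rho i by rewrite (label_between homo _ xb) ?rr.
    rewrite finset.in_setD1; apply/andP; split.
      by apply: contraTneq xb => ->; rewrite ltnn andbF.
    apply: in0; have -> : lb x = lb i by apply: val_inj.
    by apply: contraTneq xb => ->; rewrite ltnn andbF.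
  - move=> l; rewrite finset.in_setD1 negb_and negbK => /orP[/eqP->|lI0 li lr].
      by rewrite eqxx.
    have [->|mn0] := eqVneq (minor A (l |: (I0 :\ i))%SET) 0; first by rewrite mulr0.
    have cl : #|(l |: (I0 :\ i))%SET| = k.
      by rewrite cardsU1 finset.in_setD1 (negPf lI0) andbF -cI0 (cardsD1 i I0) iI0.
    have [t [rt tE]] := bases _ cl mn0.
    (* This set misses both [i] and the representative of its block, two indices with the same
       label, so it is not the complement of a transversal. *)
    have inot : i \notin (l |: (I0 :\ i))%SET by rewrite !inE eq_sym (negPf li) eqxx.
    have rnot : r (lb i) \notin (l |: (I0 :\ i))%SET.
      by rewrite !inE eq_sym (negPf lr) (negPf (rI0 _)) andbF.
    move: inot rnot; rewrite tE => /(notin_transversalC rt)[j1 e1 f1].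
    move=> /(notin_transversalC rt)[j2 e2 f2].
    case/negP: ir; apply/eqP; rewrite e2 e1; congr t; apply: val_inj.
    by rewrite /= -f1 -f2 rr.
have wA : w *m A^T = 0.
  by move: wV; rewrite memv_cap => /andP[/mem_orthov_rowspan].
have V0 : Gr_nonneg k (rowspan A).
  by exists A => // I cI; rewrite pluckerE A0.
have [rho' [b rs']] := phi_runs Wpos V0 wV w0.
have wneq i : w 0 i != 0 -> w 0 (r (lb i)) != 0 /\ 0 < q i.
  move=> wi; have := orthE _ wA i => e.
  have : (-1) ^+ i * w 0 i != 0 by rewrite mulf_neq0 ?signr_eq0.
  rewrite e !mulf_eq0 !negb_or => /andP[/andP[_ ->]] qi.
  by rewrite lt_def qi q0.
have rs : runs (n - k) rho b (signv w).
  apply: (runs_relabel rs' lab); apply: (runs_uniq rs' lab) => i j.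
  rewrite !signv_eq0 => wi wj ij; apply/eqP; rewrite altbit_eq//.
  have [wr qi] := wneq _ wi; have [_ qj] := wneq _ wj.
  rewrite (orthE _ wA i) (orthE _ wA j).
  have -> : lb j = lb i by apply: val_inj.
  have qq : 0 < q i * q j by rewrite mulr_gt0.
  rewrite mulrACA (pmulr_lgt0 _ qq) -expr2 exprn_even_gt0//.
  by rewrite mulf_neq0 ?signr_eq0.
split; first by exists b.
have wr j : w 0 (r j) != 0.
  have [_ _ /(_ j (ltn_ord j))[i ij]] := rs; rewrite signv_eq0 => /wneq[+ _].
  by have -> : lb i = j by apply: val_inj.
pose y (j : 'I_(n - k)) : 'rV[R]_n := \row_i (if rho i == j then w 0 i else 0).
have yr0 j l : l != j -> y j 0 (r l) = 0 by move=> lj; rewrite mxE rr val_eqE (negPf lj).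
have yr j : y j 0 (r j) != 0 by rewrite mxE rr eqxx.
have cardC : #|(~: [set r l | l : 'I_(n - k)])%SET| = k.
  by rewrite -I0E.
(* By [orthE] every z in V^perp is a combination of the y_j, so a vector orthogonal to all y_j lies
   in the double orthogonal complement of V; equal ranks do the rest. *)
have eqV : rowspan (kermat cardC y) = rowspan A.
  apply: rowspan_subset_eq => //; first exact: kermat_row_free.
  move=> v /(mem_kermat injr cardC yr0 yr) vy; apply: orthov_orthov => z /mem_orthov_rowspan zA.
  have zE i : z 0 i = \sum_j z 0 (r j) / w 0 (r j) * y j 0 i.
    rewrite (bigD1 (lb i))//= big1 ?addr0 => [|j ji]; last first.
      by rewrite mxE; case: eqP => [e|]; rewrite ?mulr0//; case/eqP: ji; apply: val_inj.
    rewrite mxE eqxx; have ez := orthE _ zA i; have ew := orthE _ wA i.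
    have wri := wr (lb i).
    apply: (mulfI (x := (-1) ^+ i)); first by rewrite signr_eq0.
    by rewrite ez mulrCA ew; field.
  under eq_bigr do rewrite zE mulr_suml.
  rewrite exchange_big /= big1// => j _.
  under eq_bigr do rewrite -mulrA.
  by rewrite -mulr_sumr vy mulr0.
move=> v; rewrite -eqV (mem_kermat injr cardC yr0 yr); split=> h j.
  have [jm|jm] := ltnP j (n - k).
    rewrite -[RHS](h (Ordinal jm)) big_mkcond; apply: eq_bigr => i _.
    by rewrite mxE /=; case: ifP => //; rewrite mul0r.
  by rewrite big1// => i /eqP ij; have := ltm i; rewrite ij ltnNge jm.
rewrite -[RHS](h j) [RHS]big_mkcond; apply: eq_bigr => i _.
by rewrite mxE; case: ifP => //; rewrite mul0r.
Qed.
End CellRuns.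

(** * The matroids below interval matroids *)

Lemma mem_big_direct_sum (T : finType) (s : seq {set T}) (I : {set T}) : uniq s ->
  {in s &, forall E F : {set T}, E != F -> forall i, i \in E -> i \notin F} ->
  I \in \big[@direct_sum T/[set finset.set0]%SET]_(E <- s) uniform_matroid E #|E|.-1 <->
  (forall i, i \in I -> has (fun E : {set T} => i \in E) s) /\
  {in s, forall E : {set T}, #|(I :&: E)%SET| = #|E|.-1}.
Proof.
elim: s I => [|E s IH] I /=.
  rewrite big_nil inE => _ _; split=> [/eqP->|[h _]].
    by split=> // i; rewrite inE.
  by apply/eqP/setP => i; rewrite inE; apply/negbTE/negP => /h.
move=> /andP[Es us] dis; rewrite big_cons.
have disE F i : F \in s -> i \in E -> i \in F = false.
  move=> Fs iE; apply/negbTE; apply: (dis E) iE; rewrite ?inE ?eqxx ?Fs ?orbT//.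
  by apply: contraNneq Es => ->.
have {}IH C := IH C us (fun F G Fs Gs =>
  dis F G (mem_behead (s := E :: s) Fs) (mem_behead (s := E :: s) Gs)).
split=> [/imset2P[B C]|[hI cI]].
  rewrite inE => /andP[/fintype.subsetP BE /eqP cB] /IH[hC cC] ->; split.
    move=> i; rewrite inE => /orP[/BE->//|/hC->]; exact: orbT.
  move=> F; rewrite inE => /orP[/eqP->|Fs].
    rewrite -cB; congr #|pred_of_set _|; apply/setP => i; rewrite !inE.
    have [iB|iB] := boolP (i \in B); first by rewrite BE.
    apply/negP => /= /andP[/hC/hasP[G Gs iG] iE].
    by rewrite (disE _ _ Gs iE) in iG.
  rewrite -cC//; congr #|pred_of_set _|; apply/setP => i; rewrite !inE.
  have [iF|] := boolP (i \in F); rewrite ?andbF// !andbT.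
  have [/BE iE|//] := boolP (i \in B).
  by rewrite (disE _ _ Fs iE) in iF.
apply/imset2P; exists (I :&: E)%SET (I :\: E)%SET; last by rewrite setID.
  by rewrite inE finset.subsetIr /= cI ?inE ?eqxx.
apply/IH; split=> [i|F Fs].
  by rewrite inE => /andP[iE /hI /orP[]//]; rewrite (negPf iE).
rewrite -cI ?inE ?Fs ?orbT//; congr #|pred_of_set _|; apply/setP => i; rewrite !inE.
have [iF|] := boolP (i \in F); rewrite ?andbF// !andbT.
by have [/(disE _ _ Fs)|//] := boolP (i \in E); rewrite iF.
Qed.

(** Counting the blocks that lie wholly to the left numbers the intervals from left to right.
    Distinct blocks get distinct labels below m, and there are m blocks, so every label occurs. *)
Lemma partition_labelling n m (P : {set {set 'I_n}}) :
  finset.partition P [set: 'I_n]%SET -> #|P| = m -> {in P, forall E, consecutive E} ->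
  exists2 rho : 'I_n -> nat, labelling m rho &
    forall j, (j < m)%N -> [set i | rho i == j]%SET \in P.
Proof.
move=> /and3P[/eqP cov tri n0] cP cons.
pose before (i : 'I_n) := [set E in P | [forall e in E, (e < i)%N]]%SET.
pose rho i := #|before i|.
have inP i : exists2 E, E \in P & i \in E.
  have : i \in finset.cover P by rewrite cov inE.
  by move/finset.bigcupP => [E EP iE]; exists E.
have same E F i : E \in P -> F \in P -> i \in E -> i \in F -> E = F.
  move=> EP FP iE iF; apply/eqP/negPn/negP => EF.
  by have := finset.trivIsetP tri _ _ EP FP EF => /disjointFr/(_ iE); rewrite iF.
have homo : {homo rho : i j / (i <= j)%N}.
  move=> i j ij; apply: subset_leq_card; apply/fintype.subsetP => E; rewrite !inE.
  by move=> /andP[-> /forall_inP h]; apply/forall_inP => e /h ei; apply: leq_trans ij.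
have lt E F i j : E \in P -> F \in P -> i \in E -> j \in F -> E != F ->
    (i < j)%N -> (rho i < rho j)%N.
  move=> EP FP iE jF EF ij; apply: proper_card; apply/properP; split.
    apply/fintype.subsetP => G; rewrite !inE => /andP[-> /forall_inP h].
    by apply/forall_inP => e /h ei; apply: ltn_trans ij.
  exists E; rewrite !inE EP /=.
    apply/forall_inP => e eE; rewrite ltnNge; apply/negP => je.
    have jE : j \in E by apply: (cons _ EP i j e) => //; rewrite (ltnW ij) je.
    by move: EF; rewrite (same _ _ _ EP FP jE jF) eqxx.
  by apply/negP => /forall_inP/(_ _ iE); rewrite ltnn.
have le E i j : E \in P -> i \in E -> j \in E -> (i <= j)%N -> rho i = rho j.
  move=> EP iE jE ij; apply/eqP; rewrite eqn_leq homo//=.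
  apply: subset_leq_card; apply/fintype.subsetP => F; rewrite !inE.
  move=> /andP[FP /forall_inP h]; rewrite FP; apply/forall_inP => e eF.
  rewrite ltnNge; apply/negP => ie.
  have eE : e \in E by apply: (cons _ EP i e j) => //; rewrite ie ltnW ?h.
  have := h j; rewrite ltnn (same _ _ _ FP EP eF eE) => /(_ jE) //.
have block E i : E \in P -> i \in E -> E = [set j | rho j == rho i]%SET.
  move=> EP iE; apply/setP => j; rewrite inE; apply/idP/eqP => [jE|e].
    by case/orP: (leq_total i j) => ij; [apply/esym|]; apply: (le E).
  have [F FP jF] := inP j; have [->//|FE] := eqVneq E F.
  case: (ltngtP i j) => [ij|ji|/val_inj<-//].
    by have := lt _ _ _ _ EP FP iE jF FE ij; rewrite e ltnn.
  by have := lt _ _ _ _ FP EP jF iE _ ji; rewrite e ltnn eq_sym => /(_ FE).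
have ltm i : (rho i < m)%N.
  have [E EP iE] := inP i; rewrite -cP; apply: proper_card; apply/properP; split.
    by apply/fintype.subsetP => F; rewrite inE => /andP[].
  by exists E => //; rewrite inE EP /=; apply/negP => /forall_inP/(_ _ iE); rewrite ltnn.
exists rho => // j jm.
have memE E : E \in P -> exists i, i \in E.
  move=> EP; have [E0|] := set_0Vmem E; last by case=> i; exists i.
  by move: n0; rewrite -E0 EP.
case: m => // m in cP ltm jm *.
pose f (E : {set 'I_n}) : 'I_m.+1 := inord (if [pick i in E] is Some i then rho i else 0).
have fE E i : E \in P -> i \in E -> f E = rho i :> nat.
  move=> EP iE; rewrite /f; case: pickP => [x /= xE|/(_ i)]; last by rewrite iE.
  rewrite inordK ?ltm//; have := block _ _ EP iE => e.
  by move: xE; rewrite e inE => /eqP.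
have injf : {in P &, injective f}.
  move=> E F EP FP /(congr1 val) /=; have [i iE] := memE _ EP; have [i' iF] := memE _ FP.
  rewrite (fE _ _ EP iE) (fE _ _ FP iF) (block _ _ EP iE) => e.
  by rewrite e -(block _ _ FP iF).
have : Ordinal jm \in [set f E | E in P]%SET.
  suff -> : [set f E | E in P]%SET = finset.setT by rewrite inE.
  by apply/eqP; rewrite eqEcard finset.subsetT cardsT card_ord card_in_imset// cP /=.
case/imsetP => E EP /(congr1 val) /= e; have [i iE] := memE _ EP.
by rewrite e (fE _ _ EP iE) -(block _ _ EP iE).
Qed.

(** A basis of the direct sum omits exactly one element of each block, since it meets the block E in
    #|E| - 1 elements. *)
Lemma closure_transversal n k (M : {set {set 'I_n}}) : interval_matroids_closure k M ->
  exists2 rho : 'I_n -> nat, labelling (n - k) rho &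
    forall I, I \in M -> exists t : 'I_(n - k) -> 'I_n,
      (forall j, rho (t j) = j :> nat) /\ I = (~: [set t j | j : 'I_(n - k)])%SET.
Proof.
move=> [_ [N [P [par cP cons ->]] /fintype.subsetP MN]].
have [rho lab blk] := partition_labelling par cP cons; exists rho => // I /MN.
have /and3P[_ tri n0] := par.
rewrite -big_filter => /mem_big_direct_sum[].
- by rewrite filter_uniq// index_enum_uniq.
- move=> E F; rewrite !mem_filter !mem_index_enum !andbT => EP FP EF i iE.
  by rewrite (disjointFr (finset.trivIsetP tri _ _ EP FP EF) iE).
move=> _ cI.
have one j : (j < n - k)%N -> exists i, [set x | rho x == j]%SET :\: I = [set i]%SET.
  move=> jm; set E := [set x | rho x == j]%SET; have EP : E \in P := blk _ jm.
  have E0 : (0 < #|E|)%N by rewrite card_gt0; apply: contraNneq n0 => <-.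
  have := cI E; rewrite mem_filter mem_index_enum andbT => /(_ EP); rewrite finset.setIC => c.
  have := cardsID I E; rewrite c => c'.
  by apply/cards1P; rewrite -(eqn_add2l #|E|.-1) c' addn1 prednK.
have /choice[t tP] : forall j : 'I_(n - k), exists i,
    [set x | rho x == j]%SET :\: I = [set i]%SET by move=> j; exact: one.
exists t.
have tE (j : 'I_(n - k)) x : (x == t j) = (x \notin I) && (rho x == j).
  by have /setP/(_ x) := tP j; rewrite !inE.
have rt j : rho (t j) = j by have := tE j (t j); rewrite eqxx => /esym/andP[_ /eqP].
split=> //; apply/setP => x; rewrite inE; apply/idP/negP => [xI /imsetP[j _ e]|xt].
  by have := tE j x; rewrite e eqxx -e xI.
apply/negPn/negP => xI; apply: xt; apply/imsetP; have [_ ltm] := lab.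
by exists (Ordinal (ltm x)) => //; apply/eqP; rewrite tE xI /= eqxx.
Qed.

(** The matroid is determined by [rho] and its non-coloops [X]: a basis is moved by exchanges
    towards any complement of a transversal in [X], and an exchange cannot leave a run, as that run
    would then miss two elements. *)
Lemma closure_run_bases n k (M : {set {set 'I_n}}) (rho : 'I_n -> nat) :
  is_matroid k M -> labelling (n - k) rho ->
  (forall I, I \in M -> exists t : 'I_(n - k) -> 'I_n,
      (forall j, rho (t j) = j :> nat) /\ I = (~: [set t j | j : 'I_(n - k)])%SET) ->
  exists2 s : signvec n, runs (n - k) rho false s & M = run_bases (n - k) rho (ssupp s).
Proof.
move=> [M0 cM exch] lab tr.
pose X := [set i | [exists I in M, i \notin I]]%SET.
(* The sign makes [altbit s i] equal to [odd (rho i)] on X, so the first run has bit [false]. *)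
pose s : signvec n := [ffun i => if i \in X then bsign (odd (i + rho i)) else Sg0].
have sX : ssupp s = X.
  by apply/setP => i; rewrite inE ffunE; case: ifP => //; case: (odd _).
have inX I i : I \in M -> i \notin I -> i \in X.
  by move=> IM iI; rewrite inE; apply/exists_inP; exists I.
exists s; last first.
  rewrite sX; apply/setP => I; apply/idP/idP => [IM|/run_basesP[t [tP IE]]].
    have [t [rt e]] := tr _ IM; apply/run_basesP; exists t; split=> // j.
    by split=> //; apply: (inX I) => //; rewrite e inE negbK imset_f.
  have rt j : rho (t j) = j := (tP j).1.
  have [B0 B0M] : exists B, B \in M by case/set0Pn: M0 => B; exists B.
  have [N] := ubnP #|(B0 :\: I)%SET|; elim: N B0 B0M => // N IH B BM.
  rewrite ltnS => cN.
  have [tB [rtB BE]] := tr _ BM.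
  have [/eqP|[x]] := set_0Vmem (B :\: I)%SET.
    rewrite finset.setD_eq0 => BI; suff -> : I = B by [].
    apply/esym/eqP; rewrite eqEcard BI /= IE BE.
    rewrite (card_transversalC rt (leq_subr _ _)) (card_transversalC rtB (leq_subr _ _)).
    exact: leqnn.
  rewrite inE => /andP[xI xB].
  move: (xI); rewrite {1}IE => /(notin_transversalC rt)[j xt xj].
  have : x \in X by rewrite xt; exact: (tP j).2.
  rewrite inE => /exists_inP[C CM xC].
  have [|y yCB B'M] := exch B C BM CM x; first by rewrite inE xC.
  move: yCB; rewrite inE => /andP[yB yC].
  have [tB' [rtB' B'E]] := tr _ B'M.
  have xB' : x \notin (y |: B :\ x)%SET.
    by rewrite !inE eqxx orbF; apply: contraNneq xC => ->.
  (* Were y in another run, the new basis would miss both [x] and [tB j], which carry the same label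
     j. *)
  have yj : rho y = j.
    move: (yB); rewrite BE => /(notin_transversalC rtB)[l yl ylj]; rewrite ylj.
    apply/eqP/negPn/negP => lj.
    have := notin_transversalC rtB (i := tB j); rewrite -BE.
    have tBj : tB j \notin B by rewrite BE inE negbK imset_f.
    have : tB j \notin (y |: B :\ x)%SET.
      rewrite !inE negb_or (negPf tBj) andbF andbT; apply: contraNneq lj => e.
      by rewrite -ylj -e rtB.
    rewrite B'E => /(notin_transversalC rtB')[l1 e1 f1].
    move: xB'; rewrite B'E => /(notin_transversalC rtB')[l2 e2 f2].
    have e12 : l1 = l2 by apply: val_inj; rewrite /= -f1 -f2 rtB xj.
    by move: tBj; rewrite e1 e12 -e2 xB.
  have yI : y \in I.
    rewrite IE; apply: (in_transversalC rt yj); rewrite -xt.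
    by apply: contraNneq yB => ->.
  apply: (IH _ B'M); apply: leq_trans cN; apply: proper_card; apply/properP; split.
    apply/fintype.subsetP => z; rewrite !inE => /andP[zI].
    have [zy|_ /= /andP[_ ->]] := eqVneq z y; first by rewrite zy yI in zI.
    by rewrite zI.
  by exists x; rewrite !inE ?xI ?xB//= eqxx orbF; apply: contraNneq xC => ->.
split=> //.
  move=> i; rewrite ffunE; case: ifP => // iX _; rewrite /altbit ffunE iX oddD.
  by case: (odd i); case: (odd (rho i)).
move=> j jm; case/set0Pn: M0 => I IM; have [t [rt e]] := tr _ IM.
exists (t (Ordinal jm)); first by rewrite rt.
rewrite ffunE (inX I) //; first by case: (odd _).
by rewrite e inE negbK imset_f.
Qed.

Lemma run_bases_closure n k rho b (s : signvec n) : (k < n)%N -> runs (n - k) rho b s ->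
  interval_matroids_closure k (run_bases (n - k) rho (ssupp s)).
Proof.
move=> kn rs; have [[homo ltm] _ hit] := rs; have [r hr _] := runs_reps rs.
set M := run_bases _ _ _.
have MP I : I \in M -> exists t : 'I_(n - k) -> 'I_n,
    [/\ forall j, rho (t j) = j, forall j, t j \in ssupp s &
        I = (~: [set t j | j : 'I_(n - k)])%SET].
  by move=> /run_basesP[t [tP e]]; exists t; split=> // j; have [] := tP j.
split.
  split.
  - apply/set0Pn; exists (~: [set r j | j : 'I_(n - k)])%SET.
    by apply/run_basesP; exists r; split=> // j; have [rj sj] := hr j; rewrite inE.
  - move=> I /MP[t [rt _ ->]]; rewrite (card_transversalC rt); last exact: leq_subr.
    by rewrite subKn// ltnW.
  - move=> B C /MP[t [rt tX BE]] /MP[u [ru uX CE]] x; rewrite inE => /andP[xC xB].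
    move: (xC); rewrite {1}CE => /(notin_transversalC ru)[j xu xj].
    have tx : x != t j by apply: contraTneq xB => ->; rewrite BE inE negbK imset_f.
    (* In the run of [x], B misses only [t j] and C misses only [x]; swapping the two within the run
       yields a transversal again. *)
    exists (t j).
      rewrite inE; apply/andP; split; first by rewrite BE inE negbK imset_f.
      by rewrite CE; apply: (in_transversalC ru (rt j)); rewrite -xu eq_sym.
    apply/run_basesP; exists (fun l => if l == j then x else t l); split.
      move=> l; case: eqVneq => [->|_]; last by split.
      by rewrite xj; split=> //; rewrite xu.
    apply/setP => z; rewrite !inE BE inE.
    have [->|zt] /= := eqVneq z (t j).
      apply/esym/negP => /imsetP[l _]; case: eqVneq => [_ /eqP|lj /(transversal_inj rt) e].
        by rewrite eq_sym (negPf tx).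
      by rewrite e eqxx in lj.
    have [->|zx] /= := eqVneq z x.
      by apply/esym/negbTE; rewrite negbK; apply/imsetP; exists j; rewrite ?eqxx.
    congr (~~ _); apply/imsetP/imsetP => -[l _ e].
      have lj : l != j by apply: contraNneq zt => <-; rewrite e.
      by exists l; rewrite // (negPf lj).
    move: e; case: (eqVneq l j) => [_ e|lj e]; last by exists l.
    by rewrite e eqxx in zx.
pose blk (j : 'I_(n - k)) := [set i | rho i == j]%SET.
have blkr j : r j \in blk j by rewrite inE (hr j).1.
have injb : injective blk.
  by move=> i j e; have := blkr i; rewrite e inE (hr i).1 => /eqP/val_inj.
have tri : {in [set blk j | j : 'I_(n - k)]%SET &, forall E F : {set 'I_n},
    E != F -> forall i, i \in E -> i \notin F}.
  move=> _ _ /imsetP[i _ ->] /imsetP[j _ ->] ij.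
  move=> x; rewrite !inE => /eqP xi; apply/negP => /eqP xj; case/eqP: ij; congr blk.
  by apply: val_inj; rewrite /= -xi.
eexists; first (exists [set blk j | j : 'I_(n - k)]%SET; split; last reflexivity).
- apply/and3P; split.
  + apply/eqP/setP => x; rewrite inE; apply/finset.bigcupP.
    exists (blk (Ordinal (ltm x))); first exact: imset_f.
    by rewrite inE.
  + apply/finset.trivIsetP => E F EP FP EF; rewrite -setI_eq0.
    apply/eqP/setP => x; rewrite !inE; apply/negP => /andP[xE].
    by apply/negP; exact: tri EF _ xE.
  + apply/imsetP => -[j _ e]; have := blkr j; rewrite -e; by rewrite inE.
- by rewrite card_imset// card_ord.
- move=> _ /imsetP[j _ ->] a x c; rewrite !inE => /eqP aj /eqP cj /andP[ax xc].
  by rewrite eqn_leq -{1}cj homo//= -aj homo.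
apply/fintype.subsetP => I /MP[t [rt _ IE]]; rewrite -big_filter; apply/mem_big_direct_sum.
- by rewrite filter_uniq// index_enum_uniq.
- by move=> E F; rewrite !mem_filter !mem_index_enum !andbT; exact: tri.
split.
  move=> i _; apply/hasP; exists (blk (Ordinal (ltm i))); last by rewrite inE.
  by rewrite mem_filter mem_index_enum andbT imset_f.
move=> E; rewrite mem_filter mem_index_enum andbT => /imsetP[j _ ->].
rewrite finset.setIC; have := cardsID I (blk j).
suff -> : blk j :\: I = [set t j]%SET by rewrite cards1 => <-; rewrite addn1.
apply/setP => x; rewrite !inE; apply/andP/eqP => [[xI /eqP xj]|->].
  move: xI; rewrite IE => /(notin_transversalC rt)[l xl e].
  by rewrite xl; congr t; apply: val_inj; exact: etrans (esym e) xj.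
by rewrite rt IE inE negbK imset_f.
Qed.

(** * Continuity on the Grassmannian *)

Section MatrixLimits.
Variables (R : realType) (T : Type) (F : set_system T).
Context {FF : Filter F}.

Lemma cvg_mx m n (f : T -> 'M[R]_(m, n)) (A : 'M[R]_(m, n)) :
  (forall i j, f x i j @[x --> F] --> A i j) -> f x @[x --> F] --> A.
Proof.
move=> fA U [P nP sPU]; rewrite /= nbhs_simpl /=.
have : \forall x \near F, forall i j, P i j (f x i j).
  apply: filter_forall => i; apply: filter_forall => j.
  by have := fA i j (P i j) (nP i j); rewrite nbhs_simpl.
by apply: filterS => x Px; apply: sPU.
Qed.

Lemma cvg_sumr (I : Type) (r : seq I) (P : pred I) (f : I -> T -> R) (a : I -> R) :
  (forall i, P i -> f i x @[x --> F] --> a i) ->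
  \sum_(i <- r | P i) f i x @[x --> F] --> \sum_(i <- r | P i) a i.
Proof. by apply: cvg_big => //; exact: add_continuous. Qed.

Lemma cvg_prodr (I : Type) (r : seq I) (P : pred I) (f : I -> T -> R) (a : I -> R) :
  (forall i, P i -> f i x @[x --> F] --> a i) ->
  \prod_(i <- r | P i) f i x @[x --> F] --> \prod_(i <- r | P i) a i.
Proof. by apply: cvg_big => //; exact: mul_continuous. Qed.

Lemma cvg_det n (f : T -> 'M[R]_n) (A : 'M[R]_n) :
  (forall i j, f x i j @[x --> F] --> A i j) -> \det (f x) @[x --> F] --> \det A.
Proof.
move=> fA; apply: cvg_sumr => s _; apply: cvgM; first exact: cvg_cst.
by apply: cvg_prodr => i _; exact: fA.
Qed.

Lemma cvg_mulmx m n p (f : T -> 'M[R]_(m, n)) (g : T -> 'M[R]_(n, p))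
    (A : 'M[R]_(m, n)) (B : 'M[R]_(n, p)) :
  (forall i j, f x i j @[x --> F] --> A i j) ->
  (forall i j, g x i j @[x --> F] --> B i j) ->
  forall i j, (f x *m g x) i j @[x --> F] --> (A *m B) i j.
Proof.
move=> fA gB i j; rewrite mxE; under eq_cvg do rewrite mxE.
by apply: cvg_sumr => q _; apply: cvgM; [exact: fA|exact: gB].
Qed.

Lemma cvg_adj n (f : T -> 'M[R]_n) (A : 'M[R]_n) :
  (forall i j, f x i j @[x --> F] --> A i j) ->
  forall i j, (\adj (f x)) i j @[x --> F] --> (\adj A) i j.
Proof.
move=> fA i j; rewrite mxE; under eq_cvg do rewrite mxE.
apply: cvgM; first exact: cvg_cst.
apply: cvg_det => p q; rewrite !mxE; under eq_cvg do rewrite !mxE.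
exact: fA.
Qed.
End MatrixLimits.

Lemma cvg_coord (R : realType) m n (A : 'M[R]_(m, n)) i j :
  (B : 'M[R]_(m, n)) i j @[B --> A] --> A i j.
Proof. exact: coord_continuous. Qed.

Section GrTopology.
Variables (R : realType) (n : nat).
Implicit Types (V : {vspace 'rV[R]_n}).

(** Full-rank matrices with the same row space differ by an invertible left factor, so the
    saturation of an open set is a union of open translates: [rowspan] is an open map. *)
Lemma nbhs_rowspan k (A0 : 'M[R]_(k, n)) (N : set 'M[R]_(k, n)) : row_free A0 ->
  nbhs A0 N -> nbhs (rowspan A0) [set rowspan A | A in N `&` [set A | row_free A]].
Proof.
move=> fA0 nN; rewrite nbhsE /=.
exists [set rowspan A | A in N° `&` [set A | row_free A]]; last first.
  by move=> _ [A [NA fA] <-]; exists A => //; split=> //; exact: nbhs_singleton NA.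
split; last by exists A0 => //; split=> //; exact: nbhs_interior nN.
change (Gr_open [set rowspan A | A in N° `&` [set A | row_free A]]) => k'.
apply/open_subspaceP; have [->{k'}|kk] := eqVneq k' k; last first.
  (* Full-rank matrices of another height span subspaces of another dimension. *)
  exists set0; first exact: open0.
  apply/seteqP; split=> B; first by case.
  move=> [[A [_ /= /eqP fA] e] /= /eqP fB]; exfalso; case/eqP: kk.
  have /eqmx_rank r : (A == B)%MS by apply/rowspan_eqmx.
  exact: etrans (esym fB) (etrans (esym r) fA).
exists (\bigcup_(P in [set P : 'M[R]_k | P \in unitmx]) [set B | N° (P *m B)]).
  apply: bigcup_open => P _; apply: (open_comp (f := fun B => P *m B)) => [B _|].
    have FB : Filter (nbhs B) by exact: nbhs_filter.
    apply: (@cvg_mx R _ (nbhs B)) => i j.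
    by apply: cvg_mulmx => // p q; [exact: cvg_cst|exact: cvg_coord].
  exact: open_interior.
apply/seteqP; split=> B [].
  move=> [P /= uP NPB] fB; split=> //; exists (P *m B).
    by split=> //; rewrite /= /row_free mxrankMfree// mxrank_unit.
  by apply/rowspan_eqmx/eqmxP; apply: eqmxMfull; rewrite row_full_unit.
move=> [A [NA fA] AB] fB; split=> //.
have /andP[/submxP[P AE] _] : (A == B)%MS by apply/rowspan_eqmx.
exists P => /=; last by rewrite -AE.
rewrite -row_free_unit /row_free eqn_leq rank_leq_row /=.
by rewrite -{1}(eqP fA) AE mxrankM_maxl.
Qed.

(** As [rowspan] is open, neighbourhoods of A0 have neighbourhoods as images; a lift [a] that
    represents [f] near A0 and over D is therefore enough. *)
Lemma Gr_cvg_within (D : set {vspace 'rV[R]_n}) (f : {vspace 'rV[R]_n} -> {vspace 'rV[R]_n})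
    k l (A0 : 'M[R]_(k, n)) (a : 'M[R]_(k, n) -> 'M[R]_(l, n)) :
  row_free A0 -> D (rowspan A0) -> a A @[A --> A0] --> a A0 ->
  (\forall A \near A0, row_free A -> D (rowspan A) ->
     row_free (a A) /\ f (rowspan A) = rowspan (a A)) ->
  f V @[V --> within D (nbhs (rowspan A0))] --> f (rowspan A0).
Proof.
move=> fA0 DA0 ca near_a U; rewrite /= !nbhs_simpl /= => nU.
have [fa0 eA0] := nbhs_singleton near_a fA0 DA0.
move: nU; rewrite eA0 nbhsE => -[G [oG Ga] GU].
have /open_subspaceP[Q oQ QG] := (oG : Gr_open G) l.
have Qa : nbhs (a A0) Q.
  apply: open_nbhs_nbhs; split=> //.
  by have [] : (Q `&` @full_rank R n l) (a A0) by rewrite QG; split.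
have nQ : \forall A \near A0, Q (a A) by exact: ca Qa.
apply: filterS (nbhs_rowspan fA0 (filterI near_a nQ)).
move=> _ [A [[hA QA] fA] <-] DA; apply: GU.
have [faA ->] := hA fA DA.
have : (Q `&` @full_rank R n l) (a A) by split.
by rewrite QG => -[].
Qed.

Lemma near_minor_neq0 k (A0 : 'M[R]_(k, n)) (I : {set 'I_n}) : minor A0 I != 0 ->
  \forall A \near A0, minor A I != 0.
Proof.
move=> m0; have : minor A I @[A --> A0] --> minor A0 I.
  have FA : Filter (nbhs A0) by exact: nbhs_filter.
  apply: (@cvg_det R _ (nbhs A0)) => i j.
  have [h hE hc] : exists2 h : 'M[R]_(k, n) -> R,
      forall A, (\matrix_(i < k) nth 0 [seq row i A^T | i <- enum I] i) i j = h A &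
      h A @[A --> A0] --> h A0.
    have [lt|le] := ltnP i (size (enum I)); last first.
      exists (fun=> 0); last exact: cvg_cst.
      by move=> A; rewrite mxE nth_default ?size_map// mxE.
    have [i0 _] : exists i0 : 'I_n, i0 \in enum I.
      by case: (enum I) lt => // x s _; exists x; exact: mem_head.
    exists (fun A => A j (nth i0 (enum I) i)); last exact: cvg_coord.
    by move=> A; rewrite mxE (nth_map i0)// !mxE.
  by rewrite hE (eq_cvg _ _ hE).
by move=> /cvgr_neq0; apply.
Qed.

Lemma rowspan_line (w : 'rV[R]_n) : rowspan w = <[w]>%VS.
Proof.
apply/vspaceP => v; rewrite mem_rowspan; apply/sub_rVP/vlineP => -[a ->]; by exists a.
Qed.

Lemma near_sign (A0 : 'rV[R]_n) i : A0 0 i != 0 ->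
  \forall A \near A0, sign_of ((A : 'rV[R]_n) 0 i) = sign_of (A0 0 i).
Proof.
move=> a0; have := @cvg_coord R 1 n A0 0 i => /cvgrPdist_lt/(_ `|A0 0 i|).
rewrite normr_gt0 => /(_ a0); apply: filterS => A h.
by rewrite -[A 0 i](subrKC (A0 0 i)) sign_of_perturb// distrC.
Qed.
End GrTopology.

(** * Cells and strata *)

Section Cells.
Variables (R : realType) (n k : nat).
Implicit Types (V : {vspace 'rV[R]_n}).

Lemma minor_rowspan (A B : 'M[R]_(k, n)) (I : {set 'I_n}) : rowspan A = rowspan B ->
  #|I| = k -> minor A I != 0 -> minor B I != 0.
Proof.
move=> /rowspan_eqmx/andP[/submxP[P ->] _] cI.
rewrite -!(pluckerE _ cI) /plucker; set f : 'I_k -> 'I_n := fun j => _.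
have -> : colsub f (P *m B) = P *m colsub f B.
  by apply/matrixP => i j; rewrite !mxE; apply: eq_bigr => q _; rewrite !mxE.
by rewrite det_mulmx mulf_eq0 negb_or => /andP[].
Qed.

Lemma positroid_cellP M V : positroid_cell k M V -> exists A : 'M[R]_(k, n),
  [/\ row_free A, rowspan A = V, forall I : {set 'I_n}, #|I| = k -> 0 <= minor A I &
      forall I : {set 'I_n}, #|I| = k -> (minor A I != 0) = (I \in M)].
Proof.
move=> [_ [A [fA AV] AM]]; exists A.
have AI (I : {set 'I_n}) : #|I| = k -> if I \in M then 0 < minor A I else minor A I == 0.
  move=> cI; have [h1 h2] := AM I cI; rewrite pluckerE in h1 h2.
  by case: ifPn => [/h1|/h2->].
split=> // I /AI; case: ifP => _; [exact: ltW|by move/eqP->|by move/gt_eqF->|].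
by move=> ->.
Qed.

Lemma positroid_cell_inj M M' V : is_matroid k M -> is_matroid k M' ->
  positroid_cell k M V -> positroid_cell k M' V -> M = M'.
Proof.
move=> [_ cM _] [_ cM' _] /positroid_cellP[A [_ AV _ AM]] /positroid_cellP[B [_ BV _ BM]].
apply/setP => I; apply/idP/idP => IM.
  by rewrite -BM ?cM//; apply: (@minor_rowspan A); rewrite ?AV ?BV ?AM ?cM.
by rewrite -AM ?cM'//; apply: (@minor_rowspan B); rewrite ?AV ?BV ?BM ?cM'.
Qed.

(** Nonvanishing of a minor is an open condition, so each basis of M is still a basis at nearby
    points of the cell of M'. *)
Lemma positroid_cell_closure M M' V : is_matroid k M -> is_matroid k M' ->
  positroid_cell k M V -> closure (positroid_cell k M') V -> M \subset M'.
Proof.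
move=> [_ cM _] [_ cM' _] /positroid_cellP[A [fA AV _ AM]] clV.
apply/fintype.subsetP => I IM; have cI := cM _ IM.
have mI : minor A I != 0 by rewrite AM.
have := clV _ _; have := nbhs_rowspan fA (near_minor_neq0 mI); rewrite AV.
move=> nV /(_ _ nV)[V' [/positroid_cellP[B [_ BV _ BM]] [C [mC _] CV]]].
by rewrite -BM//; apply: (@minor_rowspan C); rewrite ?BV.
Qed.
End Cells.

Lemma runs_opp n m rho b (s : signvec n) : runs m rho b s -> runs m rho (~~ b) (opp_signv s).
Proof.
move=> [lab sgn hit]; split=> // [i|j /hit[i ri si]].
  rewrite ffunE => si; have s0 : s i != Sg0 by move: si; case: (s i).
  have := sgn i s0; rewrite /altbit ffunE addNb => <-.
  by move: s0; case: (s i) => //= _; case: (odd i).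
by exists i => //; rewrite ffunE; move: si; case: (s i).
Qed.

Lemma ssupp_opp n (s : signvec n) : ssupp (opp_signv s) = ssupp s.
Proof. by apply/setP => i; rewrite !inE ffunE; case: (s i). Qed.

Lemma runs_supp_eq n m rho b (s s' : signvec n) : runs m rho b s -> runs m rho b s' ->
  ssupp s = ssupp s' -> s = s'.
Proof.
move=> [_ sgn _] [_ sgn' _] /setP e; apply/ffunP => i.
have := e i; rewrite !inE => ei.
have [s0|s0] := boolP (s i != Sg0); last first.
  by move: ei s0; case: (s i); case: (s' i).
have := sgn i s0; rewrite -(sgn' i) -?ei// /altbit => /(canLR (addbK _)).
by rewrite addbK; move: s0 ei; case: (s i); case: (s' i).
Qed.

(** Every supported index lies on some transversal, so the support is the union of the complements
    of the bases. *)
Lemma run_bases_supp n m rho b b' (s s' : signvec n) : runs m rho b s -> runs m rho b' s' ->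
  run_bases m rho (ssupp s) = run_bases m rho (ssupp s') -> ssupp s = ssupp s'.
Proof.
have sub b1 b2 (s1 s2 : signvec n) : runs m rho b1 s1 -> runs m rho b2 s2 ->
    run_bases m rho (ssupp s1) = run_bases m rho (ssupp s2) ->
    {subset ssupp s1 <= ssupp s2}.
  move=> rs1 rs2 e i si; have [r hr _] := runs_reps rs1; have [[_ ltm] _ _] := rs1.
  pose t (j : 'I_m) := if j == rho i :> nat then i else r j.
  have tP j : rho (t j) = j :> nat /\ t j \in ssupp s1.
    rewrite /t; case: eqVneq => [->|_] //.
    by rewrite inE; exact: hr.
  have : (~: [set t j | j : 'I_m])%SET \in run_bases m rho (ssupp s1).
    by apply/run_basesP; exists t.
  rewrite e => /run_basesP[u [uP eu]].
  have : i \notin (~: [set t j | j : 'I_m])%SET.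
    rewrite inE negbK; apply/imsetP; exists (Ordinal (ltm i)) => //.
    by rewrite /t eqxx.
  by rewrite eu inE negbK => /imsetP[j _ ->]; exact: (uP j).2.
by move=> rs rs' e; apply/eqP; rewrite finset.eqEsubset; apply/andP; split;
  apply/fintype.subsetP; [apply: sub rs rs' e|apply: sub rs' rs (esym e)].
Qed.

Section Strata.
Variables (R : realType) (n k : nat) (W : {vspace 'rV[R]_n}).
Hypotheses (kn : (k < n)%N) (Wpos : Gr_pos k.+1 W).

Lemma cell_blocks (M : {set {set 'I_n}}) rho (V : {vspace 'rV[R]_n}) (w : 'rV[R]_n) :
  labelling (n - k) rho ->
  (forall I, I \in M -> exists t : 'I_(n - k) -> 'I_n,
     (forall j, rho (t j) = j :> nat) /\ I = (~: [set t j | j : 'I_(n - k)])%SET) ->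
  positroid_cell k M V -> w \in phi W V -> w != 0 ->
  (exists b, runs (n - k) rho b (signv w)) /\ blocks_orth rho w V.
Proof.
move=> lab tr /positroid_cellP[A [fA <- A0 AM]] wV w0.
by apply: (phi_blocks Wpos) => // I cI; rewrite AM// => /tr.
Qed.

Lemma cell_union_blocks (V : {vspace 'rV[R]_n}) (w : 'rV[R]_n) :
  cell_union R n k V -> w \in phi W V -> w != 0 ->
  exists rho b, runs (n - k) rho b (signv w) /\ blocks_orth rho w V.
Proof.
move=> [M Mcl VM] wV w0; have [rho lab tr] := closure_transversal Mcl.
by have [[b rs] bo] := cell_blocks lab tr VM wV w0; exists rho, b.
Qed.

Lemma cell_union_nonneg (V : {vspace 'rV[R]_n}) : cell_union R n k V -> Gr_nonneg k V.
Proof. by move=> [M _ []]. Qed.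

Lemma runs_cell_phi rho b (w : 'rV[R]_n) : w \in W -> w != 0 ->
  runs (n - k) rho b (signv w) -> exists V, [/\ blocks_orth rho w V,
    positroid_cell k (run_bases (n - k) rho (ssupp (signv w))) V & phi W V = <[w]>%VS].
Proof.
move=> wW w0 rs; have [|V bo VM] := @runs_blocks_orth R n (n - k) k rho b w _ rs; first by lia.
exists V; split=> //; apply: (phi_line Wpos) => //; first by case: VM.
by rewrite memv_cap wW andbT (blocks_orth_mem bo).
Qed.

(** The labelling gives the runs of a generator w of the line, and the bases give its support;
    together they determine its sign vector up to the sign of the first run, that is up to a global
    sign. *)
Lemma phi_cell rho b (s : signvec n) : runs (n - k) rho b s ->
  phi W @` positroid_cell k (run_bases (n - k) rho (ssupp s)) =
  amplituhedron_stratum W s.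
Proof.
move=> rs; have [lab _ _] := rs; apply/seteqP; split=> L.
  move=> [V VM <-]; have [V0 _] := VM; have [w [w0 wV -> _]] := phi_ex Wpos V0.
  have [|[b' rs'] bo] := cell_blocks lab _ VM wV w0.
    by move=> I /run_basesP[t [tP ->]]; exists t; split=> // j; have [] := tP j.
  have wW : w \in W by move: wV; rewrite memv_cap => /andP[].
  have [V' [bo' VM' _]] := runs_cell_phi wW w0 rs'.
  rewrite -(blocks_orth_uniq (fun i _ => erefl) bo bo') in VM'.
  have e := positroid_cell_inj (run_bases_closure kn rs).1 (run_bases_closure kn rs').1 VM VM'.
  have es := run_bases_supp rs rs' e.
  exists w => //; split=> //; have [bb|bb] := eqVneq b b'.
    by left; apply/esym; apply: (@runs_supp_eq _ _ _ b _ _ rs); rewrite ?bb.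
  right; apply: (@runs_supp_eq _ _ _ b' _ _ rs'); last by rewrite ssupp_opp.
  by have := runs_opp rs; move: bb; case: (b); case: (b').
move=> [w [wW w0 ws] <-].
have [b' [rs' es]] : exists b', runs (n - k) rho b' (signv w) /\ ssupp (signv w) = ssupp s.
  case: ws => ->; first by exists b.
  by exists (~~ b); split; [exact: runs_opp|exact: ssupp_opp].
have [V [_ VM pV]] := runs_cell_phi wW w0 rs'.
by exists V => //; rewrite -es.
Qed.

Lemma phi_set_bij : set_bij (cell_union R n k) (amplituhedron k W) (phi W).
Proof.
split.
- by move=> V VS; exists V => //; exact: cell_union_nonneg.
- move=> V V' /set_mem VS /set_mem VS' e.
  have [w [w0 wV _ _]] := phi_ex Wpos (cell_union_nonneg VS).
  have [rho [b [rs bo]]] := cell_union_blocks VS wV w0.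
  have [|rho' [b' [[lab' sgn' _] bo']]] := cell_union_blocks VS' (w := w) _ w0; first by rewrite -e.
  apply: blocks_orth_uniq bo bo' => i wi; apply/esym; apply: (runs_uniq rs lab'); last first.
    by rewrite signv_eq0.
  by move=> p q sp sq pq; rewrite !sgn' ?pq.
- move=> _ [V V0 <-]; have [w [w0 wV -> [rho [b rs]]]] := phi_ex Wpos V0.
  have wW : w \in W by move: wV; rewrite memv_cap => /andP[].
  have [V' [_ VM <-]] := runs_cell_phi wW w0 rs.
  by exists V' => //; eexists; first exact: run_bases_closure rs.
Qed.

Lemma cells_strata_bij :
  set_bij (cells R n k) (amplituhedron_strata k W) (fun A => phi W @` A).
Proof.
split.
- move=> _ [M Mcl <-]; have [rho lab tr] := closure_transversal Mcl.
  have [s rs ->] := closure_run_bases Mcl.1 lab tr.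
  rewrite (phi_cell rs); exists s => //; split; last exact: runs_varbar rs.
  have [_ _ hit] := rs; have [|i _ si] := hit 0%N; first by rewrite subn_gt0.
  by apply: contraNneq si => ->; rewrite ffunE.
- move=> _ _ /set_mem[M Mcl <-] /set_mem[M' Mcl' <-] e.
  have [_ inj _] := phi_set_bij.
  have sub N N' : interval_matroids_closure k N -> interval_matroids_closure k N' ->
      phi W @` positroid_cell k N = phi W @` positroid_cell k N' ->
      @positroid_cell R n k N `<=` positroid_cell k N'.
    move=> Ncl Ncl' eN V VN.
    have [V' VN' eV] : (phi W @` positroid_cell k N') (phi W V) by rewrite -eN; exists V.
    suff <- : V' = V by [].
    by apply: inj => //; rewrite inE; [exists N'|exists N].
  by apply/seteqP; split; apply: sub.
- move=> _ [s [s0 vs] <-].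
  have [rho [b rs]] : exists rho b, runs (n - k) rho b s.
    by apply: altmax_runs => //; have := varbar_altmax s; rewrite vs; lia.
  exists (positroid_cell k (run_bases (n - k) rho (ssupp s))); last exact: phi_cell rs.
  by eexists; first exact: run_bases_closure rs.
Qed.
End Strata.

(** * Continuity of phi and of its inverse *)

Section Homeomorphism.
Variables (R : realType) (n k : nat) (W : {vspace 'rV[R]_n}).
Hypotheses (kn : (k < n)%N) (Wpos : Gr_pos k.+1 W).

(* Near A0, a spanning vector of V^perp :&: W is given by the cofactors of the
   row c0 in the matrix (c0; A B^T), where B spans W and c0 B spans the line at
   A0. *)
Lemma phi_cvg (V : {vspace 'rV[R]_n}) : cell_union R n k V ->
  phi W U @[U --> within (cell_union R n k) (nbhs V)] --> phi W V.
Proof.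
move=> VS; have V0 := cell_union_nonneg VS.
have [A0 [fA0 AV] _] := V0; have [B [fB BW] _] := Wpos.
have [w [w0 wV wline _]] := phi_ex Wpos V0.
have /submxP[c0 wE] : (w <= B)%MS.
  by rewrite -mem_rowspan BW; move: wV; rewrite memv_cap => /andP[].
pose M (A : 'M[R]_(k, n)) : 'M[R]_(k.+1) := col_mx c0 (A *m B^T) : 'M[R]_(1 + k, k.+1).
pose c A : 'rV[R]_k.+1 := \row_j (\adj (M A)) j 0.
pose a A : 'rV[R]_n := c A *m B.
have FA : Filter (nbhs A0) by exact: nbhs_filter.
have cvgM i j : M A i j @[A --> A0] --> M A0 i j.
  have [h hE hc] : exists2 h : 'M[R]_(k, n) -> R,
      forall A, M A i j = h A & h A @[A --> A0] --> h A0.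
    rewrite /M; have [i'|i'] := splitP (i : 'I_(1 + k)).
      move=> ii; exists (fun=> c0 i' j); last exact: cvg_cst.
      move=> A; have -> : i = lshift k i' by apply: val_inj.
      exact: col_mxEu.
    move=> ii; exists (fun A => (A *m B^T) i' j).
      move=> A; have -> : i = rshift 1 i' by apply: val_inj.
      exact: col_mxEd.
    apply: (@cvg_mulmx R _ (nbhs A0)) => // p q; last exact: cvg_cst.
    exact: cvg_coord.
  by rewrite hE (eq_cvg _ _ hE).
have MadjE A i : (M A *m (c A)^T) i 0 = (\det (M A))%:M i 0.
  by rewrite -mul_mx_adj !mxE; apply: eq_bigr => j _; rewrite !mxE.
have mulM A (v : 'rV[R]_k.+1) : M A *m v^T = col_mx (c0 *m v^T) (A *m B^T *m v^T).
  exact: (@mul_col_mx _ 1 k _ _ c0 (A *m B^T) v^T).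
(* A kernel vector v gives a point v B of the line spanned by w = c0 B, so v = x c0. The first row
   of M then says x times the sum of squares of c0 is zero, which forces v = 0. *)
have det0 : \det (M A0) != 0.
  apply/negP; rewrite -det_tr => /det0P[v v0 vM].
  have : M A0 *m v^T = 0 by rewrite -[LHS]trmxK trmx_mul trmxK vM trmx0.
  rewrite mulM => e.
  have : col_mx (c0 *m v^T) (A0 *m B^T *m v^T) = 0 :> 'M[R]_(1 + k, 1) := e.
  rewrite -col_mx0 => /eq_col_mx[cv Av].
  have : v *m B \in phi W V.
    rewrite memv_cap -BW mem_rowspan submxMl andbT -AV; apply/mem_orthov_rowspan.
    by apply: trmx_inj; rewrite !trmx_mul trmxK mulmxA Av trmx0.
  rewrite wline => /vlineP[x]; rewrite wE scalemxAl => /(row_free_inj fB) vE.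
  move: cv; rewrite vE linearZ /= -scalemxAr => /matrixP/(_ 0 0); rewrite !mxE => /eqP.
  rewrite mulf_eq0 => /orP[/eqP x0|].
    by rewrite vE x0 scale0r eqxx in v0.
  rewrite psumr_eq0 => [/allP c00|j _]; last by rewrite mxE -expr2 sqr_ge0.
  case/negP: w0; rewrite wE; apply/eqP; suff -> : c0 = 0 by rewrite mul0mx.
  apply/rowP => j; have := c00 j; rewrite mem_index_enum => /(_ isT) /=.
  by rewrite !mxE mulf_eq0 orbb => /eqP.
have near_det : \forall A \near A0, \det (M A) != 0.
  have : \det (M A) @[A --> A0] --> \det (M A0) by exact: (@cvg_det R _ (nbhs A0)).
  by move=> /cvgr_neq0; apply.
rewrite -AV in VS *; apply: (@Gr_cvg_within R n _ _ k 1 A0 a) => //.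
  apply: (@cvg_mx R _ (nbhs A0)) => i j.
  apply: (@cvg_mulmx R _ (nbhs A0)) => // p q; last exact: cvg_cst.
  have cE A : c A p q = (\adj (M A)) q 0 by rewrite mxE.
  rewrite cE (eq_cvg _ _ cE).
  exact: (@cvg_adj R _ (nbhs A0)).
apply: filterS near_det => A dA fA AS.
have aV : a A \in phi W (rowspan A).
  rewrite memv_cap -BW mem_rowspan submxMl andbT; apply/mem_orthov_rowspan.
  apply: trmx_inj; rewrite !trmx_mul trmxK mulmxA trmx0.
  apply/colP => i.
  have <- : (M A *m (c A)^T) (rshift 1 i) 0 = (A *m B^T *m (c A)^T) i 0.
    by rewrite mulM; exact: col_mxEd.
  by rewrite MadjE !mxE mulr0n.
have a0 : a A != 0.
  rewrite mulmx_free_eq0//; apply: contraNneq dA => cA.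
  by have := MadjE A 0; rewrite cA trmx0 mulmx0 !mxE eqxx mulr1n => <-.
split; first by rewrite /row_free rank_rV a0.
by rewrite rowspan_line; apply: (phi_line Wpos) => //; exact: cell_union_nonneg.
Qed.

Lemma altbit_gt0 (w : 'rV[R]_n) i (e : bool) : w 0 i != 0 ->
  (altbit (signv w) i == e) = (0 < (-1) ^+ (e (+) odd i) * w 0 i).
Proof.
move=> wi; rewrite /altbit ffunE.
have [wp|wn|w0] := ltrgt0P (w 0 i); last by rewrite w0 eqxx in wi.
  rewrite (sign_of_gt0 wp) pmulr_lgt0// signr_gt0.
  by case: e; case: (odd i).
rewrite (sign_of_lt0 wn) nmulr_lgt0// signr_lt0.
by case: e; case: (odd i).
Qed.

(* Near w0, a point w of the amplituhedron has the runs of w0, except that the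
   zeros of w0 may have joined a neighbouring run. The indices strictly between
   the representatives r_(l-1) and r_(l+1) with the sign of run l are exactly
   those of run l, so run l of w is the continuous function [nearby_run]. *)
Definition nearby_run m (r : 'I_m -> 'I_n) (b : bool) (w : 'rV[R]_n) (l : 'I_m) : 'rV[R]_n :=
  \row_i if [forall j : 'I_m, ((j < l) ==> (r j < i)) && ((l < j) ==> (i < r j))]%N
         then (w 0 i + (-1) ^+ (b (+) odd l (+) odd i) * `|w 0 i|) / 2 else 0.

Lemma nearby_runE m (r : 'I_m -> 'I_n) b rho (w : 'rV[R]_n) l i :
  runs m rho b (signv w) -> (forall j, rho (r j) = j) ->
  nearby_run r b w l 0 i = if rho i == l then w 0 i else 0.
Proof.
move=> [[homo ltm] sgn _] rr; rewrite mxE.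
have [->|wi] := eqVneq (w 0 i) 0; first by rewrite normr0 mulr0 addr0 mul0r !if_same.
have half (x : R) : (x + x) / 2 = x by field.
have si : signv w i != Sg0 by rewrite signv_eq0.
have sg (e : bool) : (e == b (+) odd (rho i)) = (0 < (-1) ^+ (e (+) odd i) * w 0 i).
  by rewrite -altbit_gt0// (sgn _ si) eq_sym.
have [il|il] := eqVneq (rho i) l.
  have -> : [forall j : 'I_m, ((j < l) ==> (r j < i)) && ((l < j) ==> (i < r j))]%N.
    apply/forallP => j; apply/andP; split; apply/implyP => jl; rewrite ltnNge;
    by apply/negP => /homo; rewrite rr il leqNgt jl.
  have := sg (b (+) odd l); rewrite il eqxx => /esym.
  case: (_ (+) odd i); rewrite ?expr1 ?expr0 ?mul1r ?mulN1r ?oppr_gt0 => wp.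
    by rewrite ltr0_norm// opprK half.
  by rewrite gtr0_norm// half.
case: ifP => // /forallP near_l.
(* The window between the neighbouring representatives confines the label to l - 1, l, l + 1; a
   label other than l has opposite parity, so its entries have the sign that the formula
   annihilates. *)
have odd_l : odd (rho i) = ~~ odd l.
  have lo : (l <= (rho i).+1)%N.
    have [->//|l0] := posnP l.
    have pm : (l.-1 < m)%N by have := ltn_ord l; lia.
    have /andP[/implyP ri _] := near_l (Ordinal pm).
    have /ltnW/homo : (r (Ordinal pm) < i)%N by apply: ri => /=; lia.
    by rewrite rr /=; lia.
  have hi : (rho i <= l.+1)%N.
    have [lm|] := ltnP l.+1 m; last by move=> ml; have := ltm i; lia.
    have := near_l (Ordinal lm); rewrite /= ltnSn /= => /andP[_ ir].
    by have := homo _ _ (ltnW ir); rewrite rr.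
  by move: lo hi il => /=; lia.
have := sg (b (+) odd l).
have -> : (b (+) odd l == b (+) odd (rho i)) = false by rewrite odd_l; case: (b); case: (odd l).
move=> /esym/negbT; rewrite -leNgt.
case: (_ (+) odd i); rewrite ?expr1 ?expr0 ?mul1r ?mulN1r ?oppr_le0 => wp.
  by rewrite ger0_norm// subrr mul0r.
by rewrite ler0_norm// subrr mul0r.
Qed.

Lemma nearby_run_cvg m (r : 'I_m -> 'I_n) b (w0 : 'rV[R]_n) l i :
  nearby_run r b w l 0 i @[w --> w0] --> nearby_run r b w0 l 0 i.
Proof.
have FA : Filter (nbhs w0) by exact: nbhs_filter.
have E w : nearby_run r b w l 0 i =
    if [forall j : 'I_m, ((j < l) ==> (r j < i)) && ((l < j) ==> (i < r j))]%N
    then (w 0 i + (-1) ^+ (b (+) odd l (+) odd i) * `|w 0 i|) / 2 else 0 by rewrite mxE.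
rewrite E (eq_cvg _ _ E); case: ifP => _; last exact: cvg_cst.
have h : (w : 'rV[R]_n) 0 i @[w --> w0] --> w0 0 i by exact: cvg_coord.
apply: cvgM; last exact: cvg_cst.
apply: cvgD => //; apply: cvgM; first exact: cvg_cst.
exact: cvg_norm.
Qed.

(** The labelling of a nearby x may vary at the zeros of w, but the representatives r_j keep their
    signs, hence their labels. The matrix [a x] is written in terms of these fixed representatives
    only. *)
Lemma phi_inv_cvg (g : {vspace 'rV[R]_n} -> {vspace 'rV[R]_n}) :
  (forall L, amplituhedron k W L -> cell_union R n k (g L) /\ phi W (g L) = L) ->
  forall L, amplituhedron k W L ->
  g U @[U --> within (amplituhedron k W) (nbhs L)] --> g L.
Proof.
move=> gP _ [V V0 <-]; have [w [w0 wV wline [rho [b rs]]]] := phi_ex Wpos V0.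
have [r hr homr] := runs_reps rs; have [lab sgn _] := rs.
have rr j : rho (r j) = j := (hr j).1.
have injr : injective r := transversal_inj rr.
have cardC : #|(~: [set r l | l : 'I_(n - k)])%SET| = k.
  by rewrite (card_transversalC rr) ?leq_subr// subKn// ltnW.
pose a (x : 'rV[R]_n) : 'M[R]_(k, n) := kermat cardC (nearby_run r b x).
have FA : Filter (nbhs w) by exact: nbhs_filter.
have fw : row_free w by rewrite /row_free rank_rV w0.
rewrite wline -rowspan_line; apply: (@Gr_cvg_within R n _ _ 1 k w a) => //.
- by rewrite rowspan_line -wline; exists V.
- apply: (@cvg_mx R _ (nbhs w)) => p q.
  have aE x : a x p q = (q == free_index cardC p)%:R -
      \sum_l nearby_run r b x l 0 (free_index cardC p) / nearby_run r b x l 0 (r l) *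
        (q == r l)%:R by rewrite mxE.
  rewrite aE (eq_cvg _ _ aE); apply: cvgB; first exact: cvg_cst.
  apply: cvg_sumr => l _; apply: cvgM; last exact: cvg_cst.
  apply: cvgM; first exact: nearby_run_cvg.
  apply: cvgV; last exact: nearby_run_cvg.
  by rewrite (nearby_runE _ _ rs)// rr eqxx -signv_eq0 (hr l).2.
have near_r : \forall x \near w, forall j, sign_of ((x : 'rV[R]_n) 0 (r j)) = sign_of (w 0 (r j)).
  apply: (@filter_forall _ 'I_(n - k)
    (fun j x => sign_of ((x : 'rV[R]_n) 0 (r j)) = sign_of (w 0 (r j))) _ FA) => j.
  by apply: near_sign; rewrite -signv_eq0 (hr j).2.
apply: filterS near_r => x xr fx xB; rewrite rowspan_line in xB *.
have x0 : x != 0 by move: fx; rewrite /row_free rank_rV; case: (x != 0).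
have [gS gx] := gP _ xB.
have xg : x \in phi W (g <[x]>%VS) by rewrite gx memv_line.
have [rho' [b' [rs' bo']]] := cell_union_blocks Wpos gS xg x0.
have sx j : signv x (r j) = signv w (r j) by rewrite !ffunE xr.
have altx j : altbit (signv x) (r j) = b (+) odd j.
  by rewrite /altbit sx -[LHS]/(altbit (signv w) (r j)) sgn ?(hr j).2// rr.
have sx0 j : signv x (r j) != Sg0 by rewrite sx (hr j).2.
have rr' : forall j, rho' (r j) = j := runs_label_rep rs' homr sx0 altx.
have bb : b' = b.
  have m0 : (0 < n - k)%N by rewrite subn_gt0.
  have [_ sgn' _] := rs'; have := altx (Ordinal m0).
  by rewrite sgn'// rr' /= !addbF.
rewrite {}bb in rs'.
have yE l i : nearby_run r b x l 0 i = if rho' i == l then x 0 i else 0.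
  exact: nearby_runE.
have yr0 j l : l != j -> nearby_run r b x j 0 (r l) = 0.
  by move=> lj; rewrite yE rr' val_eqE (negPf lj).
have yr j : nearby_run r b x j 0 (r j) != 0.
  by rewrite yE rr' eqxx -signv_eq0.
split; first exact: kermat_row_free.
apply: blocks_orth_uniq bo' _ => // v.
rewrite (mem_kermat injr cardC yr0 yr); have [[_ ltm] _ _] := rs'; split=> h j.
  have [jm|jm] := ltnP j (n - k).
    rewrite -[RHS](h (Ordinal jm)) big_mkcond; apply: eq_bigr => i _.
    by rewrite yE /=; case: ifP => //; rewrite mul0r.
  by rewrite big1// => i /eqP ij; have := ltm i; rewrite ij ltnNge jm.
rewrite -[RHS](h j) [RHS]big_mkcond; apply: eq_bigr => i _.
by rewrite yE; case: ifP => //; rewrite mul0r.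
Qed.

Lemma phi_homeomorphism :
  homeomorphism_on (cell_union R n k) (amplituhedron k W) (phi W).
Proof.
have bij := phi_set_bij kn Wpos; have [_ inj surj] := bij.
split=> //; first by apply/subspace_continuousP => V; exact: phi_cvg.
have /choice[g gP] : forall L, exists V, amplituhedron k W L ->
    cell_union R n k V /\ phi W V = L.
  move=> L; have [LB|LB] := pselect (amplituhedron k W L).
    by have [V VS VL] := surj _ LB; exists V.
  by exists 0%VS.
exists g; last by apply/subspace_continuousP => L; exact: phi_inv_cvg.
move=> V /set_mem VS; have [|gS gV] := gP (phi W V).
  by exists V => //; exact: cell_union_nonneg.
by apply: inj => //; rewrite inE.
Qed.
End Homeomorphism.

(** * Closure order and conclusion *)

(** Closures are taken in the ambient spaces, while [f] is controlled only on S. It suffices to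
    place f(A) itself, whose points come from S, in the closure of f(B), because closure is monotone
    and idempotent. *)
Lemma closure_le_image (T U : topologicalType) (S : set T) (f : T -> U) (A B : set T) :
  {within S, continuous f} -> A `<=` S -> B `<=` S ->
  closure_le A B -> closure_le (f @` A) (f @` B).
Proof.
move=> /subspace_continuousP fS AS BS AB.
have fAB : f @` A `<=` closure (f @` B).
  move=> _ [x Ax <-] N fN; have := fS x (AS _ Ax) N fN; rewrite /= nbhs_simpl /= => nx.
  have [y [By Ny]] := AB _ (subset_closure Ax) _ nx.
  by exists (f y); split; [exists y|exact: Ny (BS _ By)].
rewrite /closure_le [X in _ `<=` X](closure_id _).1; last exact: closed_closure.
exact: closure_subset.
Qed.

Lemma homeomorphism_closure_le (T U : topologicalType) (S : set T) (S' : set U)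
    (f : T -> U) (A B : set T) : homeomorphism_on S S' f -> A `<=` S -> B `<=` S ->
  closure_le A B <-> closure_le (f @` A) (f @` B).
Proof.
move=> [[fS _ _] cf [g fg cg]] AS BS; split; first exact: closure_le_image cf AS BS.
have im C : C `<=` S -> g @` (f @` C) = C.
  move=> CS; apply/seteqP; split=> [_ [_ [x Cx <-] <-]|x Cx].
    by rewrite fg// inE; exact: CS.
  by exists (f x); [exists x|rewrite fg// inE; exact: CS].
have sub C : C `<=` S -> f @` C `<=` S' by move=> CS _ [x Cx <-]; apply: fS; exact: CS.
move=> /(closure_le_image cg (sub _ AS) (sub _ BS)).
by rewrite !im.
Qed.

Lemma cells_poset (R : realType) n k : poset_on (cells R n k) (@closure_le _).
Proof.
split; [by move=> A _ V| |by move=> A B C _ _ _ AB BC; exact: subset_trans BC].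
have sub (M M' : {set {set 'I_n}}) (V : {vspace 'rV[R]_n}) : is_matroid k M -> is_matroid k M' ->
    closure_le (@positroid_cell R n k M) (@positroid_cell R n k M') ->
    positroid_cell k M V -> M \subset M'.
  move=> mM mM' le VM; apply: (positroid_cell_closure mM mM' VM).
  exact: (le _ (subset_closure VM)).
move=> _ _ [M [mM _] <-] [M' [mM' _] <-] le le'.
(* A set contained in the closure of the empty set is empty, so the two cells are both empty or both
   inhabited; points are needed to compare the matroids. *)
have [[V VM]|no] := pselect (exists V, @positroid_cell R n k M V).
  have [V' [V'M' _]] : exists V', @positroid_cell R n k M' V' /\ setT V'.
    by have [V' []] := le _ (subset_closure VM) _ filterT; exists V'.
  suff -> : M = M' by [].
  by apply/eqP; rewrite finset.eqEsubset (sub _ _ _ mM mM' le VM) (sub _ _ _ mM' mM le' V'M').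
apply/seteqP; split=> V VM; first by exfalso; apply: no; exists V.
by have [V' [V'M _]] := le' _ (subset_closure VM) _ filterT; exfalso; apply: no; exists V'.
Qed.

Theorem theorem5p17 (R : realType) (n k : nat) (W : {vspace 'rV[R]_n})
    (kn : (k < n)%N) (Wpos : Gr_pos k.+1 W) :
  homeomorphism_on (cell_union R n k) (amplituhedron k W) (phi W) /\
  poset_isomorphism
    (cells R n k) (@closure_le {vspace 'rV[R]_n})
    (amplituhedron_strata k W) (@closure_le {vspace 'rV[R]_n})
    (fun A => phi W @` A).
Proof.
have hom := phi_homeomorphism kn Wpos; split=> //.
have bij := cells_strata_bij kn Wpos; have [_ _ surj] := bij.
have cS A : cells R n k A -> A `<=` cell_union R n k.
  by move=> [M Mcl <-] V VM; exists M.
have le A B : cells R n k A -> cells R n k B ->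
    closure_le A B <-> closure_le (phi W @` A) (phi W @` B).
  by move=> /cS AS /cS BS; exact: homeomorphism_closure_le hom AS BS.
have [_ anti _] := cells_poset R n k.
split=> //; first exact: cells_poset.
split; [by move=> A _ V| |by move=> A B C _ _ _ AB BC; exact: subset_trans BC].
(* Antisymmetry for strata is pulled back to the cells, where it follows from the inclusions of
   matroids. *)
move=> X Y /surj[A cA <-] /surj[B cB <-] /(le _ _ cA cB) AB /(le _ _ cB cA) BA.
by rewrite (anti A B).
Qed.
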